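(* Let $d,D$ be positive integers with $D\geq4d+2$, and let $\phi$, $\phi_{c}$, $F_{c}$, $K$, $K^{+}$, $a_{0}$ be as in the context (in particular satisfying all the standing assumptions listed there). Then, for Lebesgue-almost every $c$ in the open ball $\{c\in\mathbb{R}^{D_{\alpha}}:\|c\|<a_{0}\}$, the delay map $F_{c}$ is injective on $K$; that is, the set of $c$ with $\|c\|<a_{0}$ for which $F_{c}|_{K}$ is injective has probability one relative to this ball.
   Context: Notation: $\pi_{i}$ denotes projection of $\mathbb{R}^{d}$ onto the $i$-th coordinate and $\mathbf{e}_{1}=(1,0,\ldots,0)\in\mathbb{R}^{d}$. For a multi-index $\alpha=(\alpha_{1},\ldots,\alpha_{d})\in\mathbb{Z}_{\geq0}^{d}$, $p_{\alpha}(x)=\prod_{i=1}^{d}(\pi_{i}x)^{\alpha_{i}}$ and $|\alpha|=\sum_i\alpha_i$. Let $\mathcal{I}_{2D-1}$ be the set of multi-indices with $|\alpha|\leq2D-1$ and $D_{\alpha}$ its cardinality; parameters are vectors $c=(c_{\alpha})_{\alpha\in\mathcal{I}_{2D-1}}\in\mathbb{R}^{D_{\alpha}}$ with the Euclidean norm. Let $\phi:\mathbb{R}^{d}\to\mathbb{R}^{d}$ be a diffeomorphism and define $\phi_{c}(x)=\phi(x)+\mathbf{e}_{1}\sum_{\alpha\in\mathcal{I}_{2D-1}}c_{\alpha}p_{\alpha}(x)$. The delay map is $F_{c}(x)=(\pi_{1}x,\pi_{1}\phi_{c}(x),\ldots,\pi_{1}\phi_{c}^{D-1}(x))\in\mathbb{R}^{D}$.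 Standing assumptions: $K$ is a compact ball in $\mathbb{R}^{d}$ centered at the origin; $K^{+}$ is a larger compact ball containing $K$ such that $\phi^{j}(x)\in K^{+}$ for all $x\in K$, $0\leq j\leq D-1$; $a_{0}>0$ is so small that $\phi_{c}^{j}(x)\in K^{+}$ for all $x\in K$, $0\leq j\leq D-1$, $\|c\|\leq a_{0}$. Moreover, for every $\|c\|\leq a_{0}$: (1) $\phi_{c}$ is a $C^{3}$ diffeomorphism of $\mathbb{R}^{d}$; (2) $\phi_{c}$ has exactly $m$ fixed points, denoted $\xi_{1}(c),\ldots,\xi_{m}(c)$ (labelled consistently in $c$); (3) $\phi_{c}$ has no other periodic points of period less than $2D$; (4) all fixed points are hyperbolic and $\pi_{1}\xi_{i}(c)\neq\pi_{1}\xi_{j}(c)$ for $i\neq j$; (5) $F_{c}$ is immersive (has injective derivative) at each fixed point. ''Probability of $A$ relative to $B$'' means $\mu(A\cap B)/\mu(B)$ with $\mu$ Lebesgue measure. *)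

(* Defs.v *)
From HB Require Import structures.
From mathcomp Require Import all_boot all_order all_algebra.
From mathcomp Require Import all_classical all_reals.
From mathcomp Require Import topology normedtype derive.
From mathcomp Require Import complex.
Set Implicit Arguments. Unset Strict Implicit. Unset Printing Implicit Defensive.
Import Order.TTheory GRing.Theory Num.Theory.
Import numFieldNormedType.Exports.
Local Open Scope classical_set_scope.
Local Open Scope ring_scope.

Section Defs.
Variable R : realType.

Definition enorm (n : nat) (x : 'rV[R]_n) : R :=
  Num.sqrt (\sum_(i < n) x ord0 i ^+ 2).

Definition cball (n : nat) (x0 : 'rV[R]_n) (r : R) : set 'rV[R]_n :=
  [set x | enorm (x - x0) <= r].

Definition basis_vec (n : nat) (i : 'I_n) : 'rV[R]_n := delta_mx ord0 i.

Fixpoint Ck (k : nat) (n p : nat) (f : 'rV[R]_n -> 'rV[R]_p) : Prop :=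
  match k with
  | 0 => continuous f
  | k'.+1 => (forall (i : 'I_n) x, derivable f x (basis_vec i)) /\
             (forall i : 'I_n, Ck k' (fun x => 'D_(basis_vec i) f x))
  end.

Definition Ck_diffeo (k n : nat) (f : 'rV[R]_n -> 'rV[R]_n) : Prop :=
  exists g : 'rV[R]_n -> 'rV[R]_n,
    cancel f g /\ cancel g f /\ Ck k f /\ Ck k g.

Definition jacobian (n p : nat) (f : 'rV[R]_n -> 'rV[R]_p) (x : 'rV[R]_n)
  : 'M[R]_(n, p) := lin1_mx ('d f x).

Definition hyperbolic_at (n : nat) (f : 'rV[R]_n -> 'rV[R]_n) (x : 'rV[R]_n) :=
  forall z : R[i], `|z| = 1 ->
    ~~ eigenvalue (map_mx (fun r : R => real_complex R r) (jacobian f x)) z.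

Definition box (n : nat) (a b : 'rV[R]_n) : set 'rV[R]_n :=
  [set x | forall i, a ord0 i <= x ord0 i <= b ord0 i].

Definition lebesgue_null (n : nat) (A : set 'rV[R]_n) : Prop :=
  forall eps : R, 0 < eps ->
    exists a b : nat -> 'rV[R]_n,
      (forall k i, a k ord0 i <= b k ord0 i) /\
      A `<=` \bigcup_k box (a k) (b k) /\
      (forall N, \sum_(k < N) \prod_(i < n) (b k ord0 i - a k ord0 i) <= eps).

(* multi-indices alpha in Z_{>=0}^d with |alpha| <= 2D-1 *)
Definition multi_index (d D : nat) :=
  {f : {ffun 'I_d -> 'I_(2 * D)} | (\sum_(i < d) (f i : nat) <= (2 * D).-1)%N}.

Definition monom (d D : nat) (al : multi_index d D) (x : 'rV[R]_d) : R :=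
  \prod_(i < d) x ord0 i ^+ (val al i : nat).

Definition Dalpha (d D : nat) : nat := #|{: multi_index d D}|.

Definition phi_c (d D : nat) (hd : (0 < d)%N) (phi : 'rV[R]_d -> 'rV[R]_d)
  (c : 'rV[R]_(Dalpha d D)) (x : 'rV[R]_d) : 'rV[R]_d :=
  phi x + (\sum_(al : multi_index d D) c ord0 (enum_rank al) * monom al x)
            *: basis_vec (Ordinal hd).
Arguments phi_c {d} D hd phi c x.

Definition delay_map (d D : nat) (hd : (0 < d)%N) (phi : 'rV[R]_d -> 'rV[R]_d)
  (c : 'rV[R]_(Dalpha d D)) (x : 'rV[R]_d) : 'rV[R]_D :=
  \row_(k < D) (iter k (phi_c D hd phi c) x) ord0 (Ordinal hd).
Arguments delay_map {d} D hd phi c x.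

End Defs.
Arguments phi_c {R d} D hd phi c x.
Arguments delay_map {R d} D hd phi c x.

(* Main.v *)
Require Import Defs.
From HB Require Import structures.
From mathcomp Require Import all_boot all_order all_algebra.
From mathcomp Require Import all_classical all_reals.
From mathcomp Require Import topology normedtype derive.
From mathcomp Require Import complex.
From mathcomp Require Import ring lra zify.
Import Order.TTheory GRing.Theory Num.Theory.
Import numFieldNormedType.Exports.
Local Open Scope classical_set_scope.
Local Open Scope ring_scope.

Set Implicit Arguments.
Unset Strict Implicit.
Unset Printing Implicit Defensive.

(** Suppose F_c x = F_c y with x <> y. By (4), x and y are not both fixed by
    phi_c, so by (3) the first points of at least one of the two orbits are
    pairwise distinct. Either one of the points lies on the forward orbit of the
    other, y = phi_c^k x with 0 < k < D, or the two orbit segments are disjoint.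
    In both cases a polynomial of degree at most 2D - 1 can be prescribed
    independently on the (at most 2D - 2) distinct points involved, so the
    c-derivative of the difference of the delay vectors is onto R^D, seen as a
    function of (c, x), respectively onto R^(D-1) (dropping the component j = 0,
    on which c does not act), seen as a function of (c, x, y). As d < D and
    2d < D - 1, near each such coincidence c is a Lipschitz function of fewer
    than dim c real parameters, hence stays in a null set; countably many of
    these neighbourhoods suffice. *)

(** * The sup norm on matrices *)

Section MatrixNorm.
Variable R : realType.

Lemma ler_mx_entry m n (x : 'M[R]_(m, n)) i j : `|x i j| <= `|x|.
Proof.
rewrite [leRHS]/Num.Def.normr/= mx_normrE.
exact: (le_bigmax_cond _ (fun ij : 'I_m * 'I_n => `|x ij.1 ij.2|) (j := (i, j))).
Qed.

Lemma ler_mx_norm m n (x : 'M[R]_(m, n)) e :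
  0 <= e -> (forall i j, `|x i j| <= e) -> `|x| <= e.
Proof.
move=> e0 xe; rewrite [leLHS]/Num.Def.normr/= mx_normrE.
by rewrite (bigmax_le _ e0)// => -[i j] _; exact: xe.
Qed.

Lemma ler_rV_norm n (x : 'rV[R]_n) e :
  0 <= e -> (forall j, `|x ord0 j| <= e) -> `|x| <= e.
Proof. by move=> e0 xe; apply: ler_mx_norm => // i j; rewrite ord1. Qed.

Lemma mulmx_bounded n p (A : 'M[R]_(n, p)) :
  exists2 C, 0 < C & forall u : 'rV[R]_n, `|u *m A| <= C * `|u|.
Proof.
exists (1 + n%:R * `|A|).
  by rewrite ltr_pwDl// mulr_ge0.
move=> u; apply: ler_rV_norm => [|j].
  by rewrite mulr_ge0// addr_ge0// mulr_ge0.
rewrite mxE (le_trans (ler_norm_sum _ _ _))//.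
apply: (@le_trans _ _ (\sum_(k < n) `|A| * `|u|)).
  apply: ler_sum => k _; rewrite normrM mulrC ler_pM// ler_mx_entry//.
rewrite sumr_const card_ord mulrDl mul1r -mulrA -[leLHS]mulr_natl.
by rewrite lerDr.
Qed.

Lemma norm_row_mx_le n p (a : 'rV[R]_n) (b : 'rV[R]_p) :
  `|row_mx a b| <= `|a| + `|b|.
Proof.
apply: ler_rV_norm => [|j]; first by rewrite addr_ge0.
rewrite mxE; case: (fintype.split j) => k.
  by rewrite (le_trans (ler_mx_entry _ _ _))// lerDl.
by rewrite (le_trans (ler_mx_entry _ _ _))// lerDr.
Qed.

Lemma norm_row_mxl n p (a : 'rV[R]_n) (b : 'rV[R]_p) : `|a| <= `|row_mx a b|.
Proof.
by apply: ler_rV_norm => // j; rewrite -(row_mxEl a b) ler_mx_entry.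
Qed.

Lemma norm_row_mxr n p (a : 'rV[R]_n) (b : 'rV[R]_p) : `|b| <= `|row_mx a b|.
Proof.
by apply: ler_rV_norm => // j; rewrite -(row_mxEr a b) ler_mx_entry.
Qed.

End MatrixNorm.

(** * Strict differentiability *)

Section StrictDifferentiability.
Variable R : realType.

(** Strict differentiability: both points of the difference vary near [u0], so two zeros of a map
    can be compared with each other and not only with [u0]. [L] is a bare function so that scalar
    maps are covered; linearity and boundedness are assumed where they serve. *)
Definition sdiff n (V : normedModType R) (f : 'rV[R]_n -> V) (u0 : 'rV[R]_n)
    (L : 'rV[R]_n -> V) :=
  forall e : R, 0 < e -> \forall w \near (u0, u0),
    `|f w.1 - f w.2 - L (w.1 - w.2)| <= e * `|w.1 - w.2|.

Definition bounded_map n (V : normedModType R) (L : 'rV[R]_n -> V) :=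
  exists2 C : R, 0 < C & forall h, `|L h| <= C * `|h|.

Lemma bounded_mulmx n p (A : 'M[R]_(n, p)) : bounded_map (fun h => h *m A).
Proof. exact: mulmx_bounded. Qed.

Lemma bounded_mulmx1 n (a : 'cV[R]_n) :
  bounded_map (fun h => (h *m a) ord0 ord0).
Proof.
have [C C0 aC] := mulmx_bounded a; exists C => // h.
by rewrite (le_trans _ (aC h))// ler_mx_entry.
Qed.

Lemma near_pair_ball n (u0 : 'rV[R]_n) (P : 'rV[R]_n * 'rV[R]_n -> Prop) :
  (\forall w \near (u0, u0), P w) <->
  exists2 e : R, 0 < e & forall u v, `|u - u0| < e -> `|v - u0| < e -> P (u, v).
Proof.
split.
  move=> /nbhs_ballP[e /= e0 eP]; exists e => // u v ue ve; apply: eP.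
  by split; rewrite /= -ball_normE /= distrC.
move=> [e e0 eP]; apply/nbhs_ballP; exists e => // -[u v] [/=].
by rewrite -!ball_normE /= => ? ?; apply: eP; rewrite distrC.
Qed.

Lemma near_pair_comp n (V : normedModType R) (f : 'rV[R]_n -> V)
    (u0 : 'rV[R]_n) (P : V * V -> Prop) :
  (forall e, 0 < e -> \forall u \near u0, `|f u0 - f u| <= e) ->
  (\forall w \near (f u0, f u0), P w) ->
  \forall w \near (u0, u0), P (f w.1, f w.2).
Proof.
move=> fc /nbhs_ballP[e /= e0 eP].
have e20 : 0 < e / 2 by rewrite divr_gt0.
have /nbhs_ballP[e' /= e'0 H] := fc _ e20.
have He u : `|u - u0| < e' -> `|f u0 - f u| < e.
  move=> ue; rewrite (@le_lt_trans _ _ (e / 2))//.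
    by apply: H; rewrite -ball_normE /= distrC.
  by rewrite ltr_pdivrMr// ltr_pMr// ltr1n.
apply/near_pair_ball; exists e' => // u v ue ve; apply: eP.
by split; rewrite /= -ball_normE /=; apply: He.
Qed.

Lemma near_fst n (u0 : 'rV[R]_n) (P : 'rV[R]_n -> Prop) :
  (\forall u \near u0, P u) -> \forall w \near (u0, u0), P w.1.
Proof.
move=> /nbhs_ballP[e /= e0 eP]; apply/near_pair_ball; exists e => // u v ue _.
by apply: eP; rewrite -ball_normE /= distrC.
Qed.

Lemma near_snd n (u0 : 'rV[R]_n) (P : 'rV[R]_n -> Prop) :
  (\forall u \near u0, P u) -> \forall w \near (u0, u0), P w.2.
Proof.
move=> /nbhs_ballP[e /= e0 eP]; apply/near_pair_ball; exists e => // u v _ ve.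
by apply: eP; rewrite -ball_normE /= distrC.
Qed.

Section Rules.
Variables (n : nat) (V : normedModType R).
Implicit Types (f g : 'rV[R]_n -> V) (u : 'rV[R]_n).

Lemma sdiff_lipschitz f u0 L : bounded_map L -> sdiff f u0 L ->
  exists2 C : R, 0 < C &
    \forall w \near (u0, u0), `|f w.1 - f w.2| <= C * `|w.1 - w.2|.
Proof.
move=> [C C0 LC] /(_ _ ltr01) fL; exists (1 + C); first by rewrite addr_gt0.
apply: filterS fL => -[u v] /= uv.
rewrite -(subrK (L (u - v)) (f u - f v)) (le_trans (ler_normD _ _))//.
by rewrite mulrDl lerD.
Qed.

Lemma sdiff_cvg f (u0 : 'rV[R]_n) L : bounded_map L -> sdiff f u0 L ->
  forall e, 0 < e -> \forall u \near u0, `|f u0 - f u| <= e.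
Proof.
move=> bL fL; have [C C0 /near_pair_ball[e e0 H]] := sdiff_lipschitz bL fL.
move=> eps eps0; apply/nbhs_ballP.
exists (Num.min e (eps / C)) => [/=|u]; first by rewrite lt_min e0 divr_gt0.
rewrite -ball_normE /= lt_min => /andP[ue ueps].
have := H u0 u; rewrite subrr normr0 [`|u - u0|]distrC => /(_ e0 ue) /= {}H.
by rewrite (le_trans H)// -ler_pdivlMl// mulrC ltW.
Qed.

Lemma sdiffD f g u0 L M : sdiff f u0 L -> sdiff g u0 M ->
  sdiff (fun u => f u + g u) u0 (fun h => L h + M h).
Proof.
move=> fL gM e e0; have e20 : 0 < e / 2 by rewrite divr_gt0.
apply: filterS2 (fL _ e20) (gM _ e20) => -[u v] /= uL uM.
have -> (a b c d x y : V) : a + b - (c + d) - (x + y) = (a - c - x) + (b - d - y).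
  by rewrite !opprD [a + b + _]addrACA [LHS]addrACA.
by rewrite (le_trans (ler_normD _ _))// (splitr e) mulrDl lerD.
Qed.

Lemma sdiff_ext f u0 L M : L =1 M -> sdiff f u0 L -> sdiff f u0 M.
Proof. by move=> /funext->. Qed.

End Rules.

Lemma sdiff_mulmx n p (A : 'M[R]_(n, p)) (u0 : 'rV[R]_n) :
  sdiff (fun u => u *m A) u0 (fun h => h *m A).
Proof.
move=> e e0; apply/near_pair_ball; exists 1 => // u v _ _ /=.
by rewrite mulmxBl subrr normr0 mulr_ge0// ltW.
Qed.

Lemma sdiff_cst n (V : normedModType R) (a : V) (u0 : 'rV[R]_n) :
  sdiff (fun=> a) u0 (fun=> 0).
Proof.
move=> e e0; apply/near_pair_ball; exists 1 => // u v _ _ /=.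
by rewrite !subrr normr0 mulr_ge0// ltW.
Qed.

Lemma sdiff_coord n p (f : 'rV[R]_n -> 'rV[R]_p) (u0 : 'rV[R]_n) (A : 'M[R]_(n, p)) :
  (forall j, sdiff (fun u => f u ord0 j) u0 (fun h => (h *m A) ord0 j)) <->
  sdiff f u0 (fun h => h *m A).
Proof.
split=> [fA e e0|fA j e e0].
  have : \forall w \near (u0, u0), forall j : 'I_p,
      `|f w.1 ord0 j - f w.2 ord0 j - ((w.1 - w.2) *m A) ord0 j|
        <= e * `|w.1 - w.2|.
    exact: (@filter_forall _ _ _ (nbhs (u0, u0)) _ (fun j => fA j e e0)).
  apply: filterS => -[u v] /= H; apply: ler_rV_norm => [|j].
    by rewrite mulr_ge0// ltW.
  by have := H j; rewrite !mxE.
apply: filterS (fA _ e0) => -[u v] /= H.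
by rewrite (le_trans _ H)// (le_trans _ (ler_mx_entry _ ord0 j))// !mxE.
Qed.

Lemma sdiff_row_mx n p q (f : 'rV[R]_n -> 'rV[R]_p) (g : 'rV[R]_n -> 'rV[R]_q)
    (u0 : 'rV[R]_n) A B :
  sdiff f u0 (fun h => h *m A) -> sdiff g u0 (fun h => h *m B) ->
  sdiff (fun u => row_mx (f u) (g u)) u0 (fun h => h *m row_mx A B).
Proof.
move=> fA gB e e0; have e20 : 0 < e / 2 by rewrite divr_gt0.
apply: filterS2 (fA _ e20) (gB _ e20) => -[u v] /= uA uB.
rewrite mul_mx_row !opp_row_mx !add_row_mx.
by rewrite (le_trans (norm_row_mx_le _ _))// (splitr e) mulrDl lerD.
Qed.

Lemma sdiff_comp n p (V : normedModType R) (f : 'rV[R]_n -> 'rV[R]_p)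
    (g : 'rV[R]_p -> V) (u0 : 'rV[R]_n) (A : 'M[R]_(n, p)) (M : 'rV[R]_p -> V) :
  {morph M : x y / x + y} -> bounded_map M ->
  sdiff f u0 (fun h => h *m A) -> sdiff g (f u0) M ->
  sdiff (g \o f) u0 (fun h => M (h *m A)).
Proof.
move=> MD [C C0 MC] fA gM e e0.
have fcont := sdiff_cvg (bounded_mulmx A) fA.
have [K K0 fK] := sdiff_lipschitz (bounded_mulmx A) fA.
(* Half of [e] goes to the error of [g] between [f u] and [f v], whose distance is at most [K] times
   that of [u] and [v]; the other half goes to [M] applied to the error of [f]. *)
have eK0 : 0 < e / 2 / K by rewrite !divr_gt0.
have eC0 : 0 < e / 2 / C by rewrite !divr_gt0.
apply: filterS3 fK (fA _ eC0) (near_pair_comp fcont (gM _ eK0)) => -[u v] /= uK uC uM.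
rewrite [X in `|X|](_ : _ = (g (f u) - g (f v) - M (f u - f v)) +
   M (f u - f v - (u - v) *m A)); last first.
  have <- : M (f u - f v - (u - v) *m A) + M ((u - v) *m A) = M (f u - f v).
    by rewrite -MD subrK.
  by rewrite opprD [in RHS]addrA [RHS]addrAC subrK.
rewrite (le_trans (ler_normD _ _))// (splitr e) mulrDl lerD//.
  by rewrite (le_trans uM)// -[e / 2 / K * _]mulrA ler_pM2l ?divr_gt0// ler_pdivrMl.
rewrite (le_trans (MC _))// -ler_pdivlMl// mulrA [C^-1 * _]mulrC.
exact: uC.
Qed.

Lemma sdiffM n (f g : 'rV[R]_n -> R) (u0 : 'rV[R]_n) L M :
  bounded_map L -> bounded_map M -> sdiff f u0 L -> sdiff g u0 M ->
  sdiff (fun u => f u * g u) u0 (fun h => f u0 * M h + g u0 * L h).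
Proof.
move=> bL bM fL gM e e0; have [C C0 LC] := bL; have [D D0 MD] := bM.
have fc := sdiff_cvg bL fL; have gc := sdiff_cvg bM gM.
have e40 : 0 < e / 4 by rewrite divr_gt0.
have eC0 : 0 < e / 4 / C by rewrite divr_gt0.
have eD0 : 0 < e / 4 / D by rewrite divr_gt0.
pose F := `|f u0| + 1; pose G := `|g u0| + 1.
have F0 : 0 < F by rewrite ltr_wpDl.
have G0 : 0 < G by rewrite ltr_wpDl.
near=> w.
set h := w.1 - w.2.
(* In each of the four products one factor is bounded (by [F], [G], or a multiple of the norm of
   [h]) and the other is small, so each can be held below a quarter of [e]. *)
rewrite [X in `|X|](_ : _ = f w.1 * (g w.1 - g w.2 - M h) + (f w.1 - f u0) * M h
  + (g w.2 * (f w.1 - f w.2 - L h) + (g w.2 - g u0) * L h)); last by ring.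
have f1 : `|f w.1| <= F.
  rewrite -(subrK (f u0) (f w.1)) (le_trans (ler_normD _ _))// addrC lerD2l distrC.
  by near: w; exact: (near_fst (fc _ ltr01)).
have g1 : `|g w.2| <= G.
  rewrite -(subrK (g u0) (g w.2)) (le_trans (ler_normD _ _))// addrC lerD2l distrC.
  by near: w; exact: (near_snd (gc _ ltr01)).
have H1 : `|g w.1 - g w.2 - M h| <= e / 4 / F * `|h|.
  by rewrite /h; near: w; apply: gM; rewrite divr_gt0.
have H2 : `|f w.1 - f w.2 - L h| <= e / 4 / G * `|h|.
  by rewrite /h; near: w; apply: fL; rewrite divr_gt0.
have H3 : `|f w.1 - f u0| <= e / 4 / D.
  by rewrite distrC; near: w; exact: (near_fst (fc _ eD0)).
have H4 : `|g w.2 - g u0| <= e / 4 / C.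
  by rewrite distrC; near: w; exact: (near_snd (gc _ eC0)).
have prodle a b A B E : 0 < A -> `|a| <= A -> `|b| <= E / A * B ->
    `|a * b| <= E * B :> R.
  move=> A0 aA bB; rewrite normrM (le_trans (ler_pM _ _ aA bB))//.
  by rewrite mulrA mulrCA divff ?gt_eqF// mulr1.
have P1 := prodle _ _ _ _ _ F0 f1 H1.
have P2 := prodle _ _ _ _ _ G0 g1 H2.
have prodle' a b A B E : 0 < A -> `|a| <= E / A -> `|b| <= A * B ->
    `|a * b| <= E * B :> R.
  move=> A0 aA bB; rewrite normrM (le_trans (ler_pM _ _ aA bB))//.
  by rewrite mulrA -[E / A * A]mulrA mulVf ?gt_eqF// mulr1.
have P3 := prodle' _ _ _ _ _ D0 H3 (MD h).
have P4 := prodle' _ _ _ _ _ C0 H4 (LC h).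
rewrite (le_trans (ler_normD _ _))// (_ : e = (e/4 + e/4) + (e/4+e/4)); last by field.
rewrite !(mulrDl _ _ `|h|) lerD// (le_trans (ler_normD _ _))// lerD//.
Unshelve. all: by end_near. Qed.

End StrictDifferentiability.

(** * Null sets *)

Section NullSets.
Variable R : realType.

Lemma lebesgue_null_sub n (A B : set 'rV[R]_n) :
  A `<=` B -> lebesgue_null B -> lebesgue_null A.
Proof.
move=> AB nB e e0; have [a [b [ab [Bab sab]]]] := nB e e0.
by exists a, b; split=> //; split=> // x /AB /Bab.
Qed.

Definition volume n (a b : 'rV[R]_n) : R := \prod_(i < n) (b ord0 i - a ord0 i).

Lemma volume_ge0 n (a b : 'rV[R]_n) :
  (forall i, a ord0 i <= b ord0 i) -> 0 <= volume a b.
Proof. by move=> ab; apply: prodr_ge0 => i _; rewrite subr_ge0. Qed.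

Lemma volume0 n (a : 'rV[R]_n.+1) : volume a a = 0.
Proof. by rewrite /volume big_ord_recl subrr mul0r. Qed.

Lemma ler_sum_uniq (I : eqType) (s t : seq I) (F : I -> R) :
  uniq s -> uniq t -> {subset s <= t} -> (forall i, 0 <= F i) ->
  \sum_(i <- s) F i <= \sum_(i <- t) F i.
Proof.
move=> us ut st F0; rewrite [leRHS](bigID (mem s)) /=.
have st' : perm_eq [seq i <- t | i \in s] s.
  apply: uniq_perm => [||x] //; first exact: filter_uniq.
  by rewrite mem_filter; case: (boolP (x \in s)) => //= /st ->.
have -> : \sum_(i <- t | i \in s) F i = \sum_(i <- s) F i.
  by rewrite -big_filter; exact: perm_big.
by rewrite lerDl sumr_ge0.
Qed.

(* Junk indices of the enumeration get a degenerate box, which has volume zero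
   only because the dimension is positive. *)
Lemma lebesgue_null_count n (A : set 'rV[R]_n) : (0 < n)%N ->
  (forall e : R, 0 < e -> exists (I : countType) (a b : I -> 'rV[R]_n),
    [/\ forall k i, a k ord0 i <= b k ord0 i,
        A `<=` [set x | exists k, box (a k) (b k) x] &
        forall s : seq I, uniq s -> \sum_(k <- s) volume (a k) (b k) <= e]) ->
  lebesgue_null A.
Proof.
case: n A => // n A _ H e e0; have [I [a [b [ab Aab sab]]]] := H e e0.
pose a' k := oapp a 0 (pickle_inv k : option I).
pose b' k := oapp b 0 (pickle_inv k : option I).
exists a', b'; split; first by rewrite /a' /b' => k i; case: pickle_inv => //=.
split.
  move=> x /Aab[k kx]; exists (pickle k) => //.
  by rewrite /a' /b' pickleK_inv.
move=> N; pose s := pmap (@pickle_inv I) (iota 0 N).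
have us : uniq s.
  by apply: (pmap_uniq (@pickle_invK I)); exact: iota_uniq.
apply: le_trans (sab s us).
rewrite -(big_mkord xpredT (fun k => volume (a' k) (b' k))) /index_iota subn0.
rewrite {us}/s; elim: iota => [|k l IH] /=; first by rewrite !big_nil.
rewrite big_cons /a' /b'; case: (pickle_inv k) => [j|] /=.
  by rewrite big_cons lerD2l.
by rewrite volume0 add0r.
Qed.

Lemma lebesgue_null0 n : (0 < n)%N -> lebesgue_null (set0 : set 'rV[R]_n).
Proof.
move=> n0; apply: lebesgue_null_count => // e e0.
exists void, (fun=> 0), (fun=> 0); split=> //.
by case=> [|[]]// _; rewrite big_nil ltW.
Qed.

Lemma sum_half_pow (e : R) K : 0 <= e -> \sum_(i < K) e / 2 ^+ i.+1 <= e.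
Proof.
move=> e0; have -> : \sum_(i < K) e / 2 ^+ i.+1 = e - e / 2 ^+ K.
  elim: K => [|K IH]; first by rewrite big_ord0 expr0 divr1 subrr.
  rewrite big_ord_recr /= IH exprSr invfM mulrA; lra.
by rewrite gerBl divr_ge0// exprn_ge0.
Qed.

(** Countable subadditivity: the [i]-th set gets the budget [e / 2 ^+ (pickle i).+1], and all boxes
    together are indexed by pairs. *)
Lemma lebesgue_null_bigcup (I : countType) n (A : I -> set 'rV[R]_n) :
  (0 < n)%N -> (forall i, lebesgue_null (A i)) ->
  lebesgue_null [set x | exists i, A i x].
Proof.
move=> n0 nA; apply: lebesgue_null_count => // e e0; exists (I * nat)%type.
have ei (i : I) : 0 < e / 2 ^+ (pickle i).+1 :> R by rewrite divr_gt0// exprn_gt0.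
have /choice[ab abP] : forall i, exists ab : (nat -> 'rV[R]_n) * (nat -> 'rV[R]_n),
    [/\ forall k j, ab.1 k ord0 j <= ab.2 k ord0 j,
        A i `<=` \bigcup_k box (ab.1 k) (ab.2 k) &
        forall N, \sum_(k < N) volume (ab.1 k) (ab.2 k) <= e / 2 ^+ (pickle i).+1].
  move=> i; have [a [b [? [? ?]]]] := nA i _ (ei i).
  by exists (a, b).
exists (fun p => (ab p.1).1 p.2), (fun p => (ab p.1).2 p.2); split.
- by move=> [i k] j /=; have [] := abP i.
- move=> x [i Aix]; have [_ + _] := abP i; move=> /(_ x Aix)[k _ kx].
  by exists (i, k).
move=> s us; pose F p := volume ((ab p.1).1 p.2) ((ab p.1).2 p.2).
have F0 p : 0 <= F p.
  by apply: volume_ge0 => j; case: p => i k /=; have [] := abP i.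
pose si := undup (map fst s).
pose K := (\max_(p <- s) p.2).+1.
rewrite -[leLHS]/(\sum_(p <- s) F p).
(* The finite family [s] is enlarged to a full rectangle of pairs, so that the sum can be taken one
   set at a time. *)
apply: (@le_trans _ _ (\sum_(p <- [seq (i, k) | i <- si, k <- iota 0 K]) F p)).
  apply: ler_sum_uniq => //.
    by apply: allpairs_uniq; rewrite ?undup_uniq ?iota_uniq// => -[? ?] [? ?].
  move=> [i k] iks; apply/allpairsP; exists (i, k); split=> //=.
    by rewrite mem_undup; apply/mapP; exists (i, k).
  have kK : (k <= \max_(p <- s) p.2)%N.
    exact: (leq_bigmax_seq _ iks).
  by rewrite /K in_cons mem_iota; case: k kK {iks}.
rewrite big_allpairs.
apply: (@le_trans _ _ (\sum_(i <- si) e / 2 ^+ (pickle i).+1)).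
  apply: ler_sum => i _; have [_ _ /(_ K)] := abP i.
  rewrite -(big_mkord xpredT (fun k => F (i, k))).
  by rewrite /index_iota subn0.
pose L := (\max_(i <- si) pickle i).+1.
rewrite -(big_map pickle xpredT (fun k => e / 2 ^+ k.+1)).
apply: le_trans (sum_half_pow L (ltW e0)).
rewrite -(big_mkord xpredT (fun k => e / 2 ^+ k.+1)) /index_iota subn0.
apply: ler_sum_uniq.
- by rewrite map_inj_uniq ?undup_uniq//; exact: pcan_inj pickleK.
- exact: iota_uniq.
- move=> _ /mapP[i isi ->]; rewrite mem_iota /= add0n ltnS.
  exact: (leq_bigmax_seq _ isi).
- by move=> k; rewrite divr_ge0 ?exprn_ge0// ltW.
Qed.

(* A grid of mesh 1/m on the bounded set u @` Z has O(m^M) cells, and f maps the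
   points over a cell into a cube of side O(1/m): total volume O(m^(M-N)). *)
Lemma lipschitz_image_null (T : Type) M N (Z : set T) (u : T -> 'rV[R]_M)
    (f : T -> 'rV[R]_N) (b C : R) : (M < N)%N ->
  (forall z, Z z -> `|u z| <= b) ->
  (forall z z', Z z -> Z z' -> `|f z - f z'| <= C * `|u z - u z'|) ->
  lebesgue_null (f @` Z).
Proof.
move=> MN ub fC.
wlog b0 : b ub / 0 < b.
  move=> H; apply: (H (`|b| + 1)); last by rewrite ltr_wpDl.
  by move=> z /ub zb; rewrite (le_trans zb)// (le_trans (ler_norm _))// lerDl.
wlog C0 : C fC / 0 < C.
  move=> H; apply: (H (`|C| + 1)); last by rewrite ltr_wpDl.
  move=> z z' Zz Zz'; rewrite (le_trans (fC z z' Zz Zz'))// ler_wpM2r//.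
  by rewrite (le_trans (ler_norm _))// lerDl.
have N0 : (0 < N)%N by case: N MN f fC.
have [[z0 _]|Z0] := pselect (exists z, Z z); last first.
  by apply: lebesgue_null_sub (lebesgue_null0 N0) => x [z Zz _]; case: Z0; exists z.
(* [K / m] will bound the total volume: there are at most [(2 * m) ^+ M] cells, each giving a cube
   of side [2 * C * h = 4 * C * b / m]. *)
apply: lebesgue_null_count => // e e0; pose K : R := 2 ^+ M * (4 * C * b) ^+ N.
have K0 : 0 < K by rewrite mulr_gt0 ?exprn_gt0// !mulr_gt0.
pose m := (Num.truncn (K / e)).+1.
have m0 : 0 < m%:R :> R by rewrite ltr0n.
have Km : K / m%:R <= e.
  rewrite ler_pdivrMr// mulrC -ler_pdivrMr// ltW//.
  by rewrite truncnS_gt.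
pose h : R := 2 * b / m%:R.
have h0 : 0 < h by rewrite divr_gt0// mulr_gt0.
(* There are [m.+1] cells per axis rather than [m], because a coordinate equal to [b] has quotient
   exactly [m]. *)
pose cell z : {ffun 'I_M -> 'I_m.+1} :=
  [ffun i => inord (Num.truncn ((u z ord0 i + b) / h))].
have cellP z i : Z z ->
    (cell z i)%:R <= (u z ord0 i + b) / h < (cell z i).+1%:R.
  move=> Zz; have := le_trans (ler_mx_entry (u z) ord0 i) (ub z Zz).
  rewrite ler_norml => /andP[l r].
  have x0 : 0 <= (u z ord0 i + b) / h.
    by rewrite divr_ge0 ?(ltW h0)// -[b]opprK subr_ge0.
  have xm : (u z ord0 i + b) / h <= m%:R.
    rewrite ler_pdivrMr// /h mulrC divfK ?gt_eqF//; lra.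
  rewrite ffunE inordK; first exact: truncn_itv.
  by rewrite ltnS -(ler_nat R) (le_trans _ xm)// truncn_le.
have cell_dist z z' : Z z -> Z z' -> cell z = cell z' -> `|u z - u z'| <= h.
  move=> Zz Zz' zz'; apply: ler_rV_norm => [|i]; first exact: ltW.
  have /andP[l1 r1] := cellP z i Zz; have /andP[l2 r2] := cellP z' i Zz'.
  move: l1 r1 l2 r2; rewrite zz' !(ler_pdivlMr _ _ h0) !(ltr_pdivrMr _ _ h0).
  rewrite -natr1 !(mulrDl _ _ h) !mxE ler_norml => l1 r1 l2 r2.
  by apply/andP; split; lra.
(* A point of [Z] is chosen over each occupied cell; over an empty cell the choice is arbitrary. *)
have /choice[rep repP] : forall k, exists z1,
    (exists z, Z z /\ cell z = k) -> Z z1 /\ cell z1 = k.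
  move=> k; have [[z ?]|] := pselect (exists z, Z z /\ cell z = k).
    by exists z.
  by exists z0.
pose H : 'rV[R]_N := const_mx (C * h).
have vol k : volume (f (rep k) - H) (f (rep k) + H) = (2 * C * h) ^+ N.
  rewrite /volume (eq_bigr (fun=> 2 * C * h)).
    by rewrite prodr_const card_ord.
  by move=> i _; rewrite !mxE; ring.
exists {ffun 'I_M -> 'I_m.+1}, (fun k => f (rep k) - H), (fun k => f (rep k) + H).
have Ch0 : 0 < C * h by rewrite mulr_gt0.
split.
- by move=> k i; rewrite !mxE; lra.
- move=> x [z Zz <-]; exists (cell z) => i.
  have [|Zr rz] := repP (cell z); first by exists z.
  have := fC z _ Zz Zr.
  have := ler_mx_entry (f z - f (rep (cell z))) ord0 i.
  have := ler_wpM2l (ltW C0) (cell_dist _ _ Zz Zr (esym rz)).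
  move=> h1 h2 h3; have := le_trans (le_trans h2 h3) h1.
  by rewrite !mxE ler_norml => /andP[? ?]; apply/andP; split; lra.
move=> s us; apply: (le_trans _ Km).
apply: (@le_trans _ _ (\sum_(k <- enum {ffun 'I_M -> 'I_m.+1}) (2 * C * h) ^+ N)).
  rewrite (eq_bigr _ (fun k _ => vol k)); apply: ler_sum_uniq => //.
  - exact: enum_uniq.
  - by move=> k _; rewrite mem_enum.
  - by move=> _; rewrite exprn_ge0// -mulrA mulr_ge0// ltW.
rewrite big_const_seq count_predT -cardE card_ffun !card_ord iter_addr_0.
have -> : 2 * C * h = 4 * C * b / m%:R by rewrite /h; field; rewrite gt_eqF.
rewrite -[_ *+ _]mulr_natr natrX expr_div_n.
have m1 : m.+1%:R <= 2 * m%:R :> R by rewrite -natrM ler_nat /m; lia.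
have B0 : 0 < (4 * C * b) ^+ N by rewrite exprn_gt0// !mulr_gt0.
apply: (@le_trans _ _ ((4 * C * b) ^+ N / m%:R ^+ N * (2 * m%:R) ^+ M)).
  apply: ler_wpM2l; first by rewrite ltW// divr_gt0// exprn_gt0.
  by apply: lerXn2r => //; rewrite nnegrE ?ler0n// mulr_ge0.
have -> : (4 * C * b) ^+ N / m%:R ^+ N * (2 * m%:R) ^+ M =
    K * (m%:R ^+ M / m%:R ^+ N).
  by rewrite /K [(2 * m%:R) ^+ M]exprMn; ring.
(* As [M < N], the quotient of powers of [m] is at most [1 / m]. *)
rewrite ler_pM2l// -(subnK MN) addnS -addSn exprD.
rewrite invfM mulrCA divff ?expf_neq0 ?gt_eqF// mulr1 lef_pV2 ?posrE ?exprn_gt0//.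
rewrite exprS; apply: ler_peMr; first exact: ltW.
by apply: exprn_ege1; rewrite ler1n.
Qed.

End NullSets.

(** * Interpolation by the perturbing polynomials *)

Section Interpolation.
Variables (R : realType) (d D : nat).
Local Notation N := (Dalpha d D).

Definition pert (c : 'rV[R]_N) (x : 'rV[R]_d) : R :=
  \sum_(al : multi_index d D) c ord0 (enum_rank al) * monom al x.

Lemma pertD c c' x : pert (c + c') x = pert c x + pert c' x.
Proof.
by rewrite /pert -big_split; apply: eq_bigr => al _; rewrite mxE mulrDl.
Qed.

Lemma pertZ a c x : pert (a *: c) x = a * pert c x.
Proof.
by rewrite /pert mulr_sumr; apply: eq_bigr => al _; rewrite mxE mulrA.
Qed.

Definition mdeg (al : multi_index d D) : nat := \sum_(i < d) (val al i : nat).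

(** The degree is tracked because multiplication by a coordinate stays within the available
    polynomials only below degree [2 * D]. *)
Definition pert_deg (m : nat) (f : 'rV[R]_d -> R) :=
  exists2 c : 'rV[R]_N, f =1 pert c &
    forall al, (m < mdeg al)%N -> c ord0 (enum_rank al) = 0.

Lemma pert_degD m f g : pert_deg m f -> pert_deg m g ->
  pert_deg m (fun x => f x + g x).
Proof.
move=> [c fc cm] [c' gc' c'm]; exists (c + c') => [x|al mal].
  by rewrite pertD fc gc'.
by rewrite mxE cm// c'm// addr0.
Qed.

Lemma pert_degZ m a f : pert_deg m f -> pert_deg m (fun x => a * f x).
Proof.
move=> [c fc cm]; exists (a *: c) => [x|al mal].
  by rewrite pertZ fc.
by rewrite mxE cm// mulr0.
Qed.

Lemma pert_deg0 m : pert_deg m (fun=> 0).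
Proof.
exists 0 => [x|al _]; last by rewrite mxE.
by rewrite /pert big1// => al _; rewrite mxE mul0r.
Qed.

Lemma pert_deg_sum m (I : Type) (s : seq I) (P : pred I) (F : I -> 'rV[R]_d -> R) :
  (forall i, P i -> pert_deg m (F i)) ->
  pert_deg m (fun x => \sum_(i <- s | P i) F i x).
Proof.
move=> HF; elim: s => [|i s IH].
  have [c c0 cm] := pert_deg0 m; exists c => // x.
  by rewrite big_nil -c0.
have [Pi|Pi] := boolP (P i).
  have [c cE cm] := pert_degD (HF i Pi) IH; exists c => // x.
  by rewrite big_cons Pi -cE.
by have [c cE cm] := IH; exists c => // x; rewrite big_cons (negbTE Pi) -cE.
Qed.

Lemma pert_degW m m' f : (m <= m')%N -> pert_deg m f -> pert_deg m' f.
Proof.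
by move=> mm' [c fc cm]; exists c => // al h; rewrite cm// (leq_ltn_trans mm').
Qed.

Lemma pert_deg_monom al : pert_deg (mdeg al) (monom al).
Proof.
exists (delta_mx ord0 (enum_rank al)) => [x|be].
  rewrite /pert (bigD1 al)//= mxE !eqxx mul1r big1 ?addr0// => be beal.
  by rewrite mxE (inj_eq enum_rank_inj) (negbTE beal) andbF mul0r.
have [->|beal _] := eqVneq be al; first by rewrite ltnn.
by rewrite mxE (inj_eq enum_rank_inj) (negbTE beal) andbF.
Qed.

Lemma pert_deg_monomX al k : ((mdeg al).+1 < 2 * D)%N ->
  pert_deg (mdeg al).+1 (fun x => x ord0 k * monom al x).
Proof.
move=> h.
have le i : (val al i <= mdeg al)%N by rewrite /mdeg (bigD1 i)//= leq_addr.
(* Exponents live in ['I_(2 * D)], so the raised exponent has to be bounded before the new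
   multi-index can be formed. *)
have lt i : (val al i + (i == k) < 2 * D)%N.
  apply: (leq_ltn_trans _ h); rewrite -[X in (_ <= X)%N]addn1 leq_add//.
  by case: eqP.
pose f : {ffun 'I_d -> 'I_(2 * D)} := [ffun i => Ordinal (lt i)].
have fdeg : (\sum_(i < d) (f i : nat) = (mdeg al).+1)%N.
  under eq_bigr do rewrite ffunE /=.
  rewrite big_split /= -/(mdeg al) -addn1; congr addn.
  by rewrite (bigD1 k)//= eqxx big1 ?addn0// => i /negbTE ->.
have fP : (\sum_(i < d) (f i : nat) <= (2 * D).-1)%N.
  by rewrite fdeg -ltnS prednK// (leq_trans _ h).
pose be : multi_index d D := exist _ f fP.
have -> : (fun x : 'rV[R]_d => x ord0 k * monom al x) = monom be.
  apply/funext => x; rewrite /monom /=.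
  rewrite [RHS](eq_bigr (fun i => x ord0 i ^+ (i == k) * x ord0 i ^+ (val al i))).
    rewrite big_split /=; congr (_ * _).
    by rewrite (bigD1 k)//= eqxx expr1 big1 ?mulr1// => i /negbTE ->; rewrite expr0.
  by move=> i _; rewrite ffunE /= exprD mulrC.
have -> : (mdeg al).+1 = mdeg be by rewrite -fdeg.
exact: pert_deg_monom.
Qed.

Lemma pert_degX m k f : (m.+1 < 2 * D)%N -> pert_deg m f ->
  pert_deg m.+1 (fun x => x ord0 k * f x).
Proof.
move=> mD [c fc cm].
have -> : (fun x : 'rV_d => x ord0 k * f x) = fun x : 'rV_d =>
    \sum_(al | (mdeg al <= m)%N) c ord0 (enum_rank al) * (x ord0 k * monom al x).
  apply/funext => x; rewrite fc /pert mulr_sumr.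
  rewrite (bigID (fun al => (mdeg al <= m)%N)) /= [X in _ + X]big1 ?addr0.
    by apply: eq_bigr => al _; rewrite mulrCA.
  by move=> al; rewrite -ltnNge => /cm ->; rewrite mul0r mulr0.
apply: pert_deg_sum => al alm; apply: pert_degZ.
by apply: pert_degW (pert_deg_monomX k _) => //; exact: leq_ltn_trans mD.
Qed.

Lemma pert_deg_cst : (0 < D)%N -> pert_deg 0 (fun=> 1).
Proof.
move=> D0; have D20 : (0 < 2 * D)%N by rewrite muln_gt0.
pose f : {ffun 'I_d -> 'I_(2 * D)} := [ffun=> Ordinal D20].
have f0 : (\sum_(i < d) (f i : nat) = 0)%N by rewrite big1// => i _; rewrite ffunE.
have fP : (\sum_(i < d) (f i : nat) <= (2 * D).-1)%N by rewrite f0.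
pose be : multi_index d D := exist _ f fP.
have <- : monom be = (fun _ : 'rV[R]_d => 1).
  by apply/funext => x; rewrite /monom big1// => i _; rewrite ffunE expr0.
by rewrite -[0%N]f0; exact: pert_deg_monom.
Qed.

(** A product of affine factors, one per point of [s]: each factor uses a coordinate in which that
    point differs from [y], vanishes at the point and is normalized to 1 at [y]. *)
Lemma pert_separate (s : seq 'rV[R]_d) (y : 'rV[R]_d) :
  (size s < 2 * D)%N -> y \notin s ->
  exists2 f, pert_deg (size s) f & f y = 1 /\ {in s, forall x, f x = 0}.
Proof.
move=> sD; have D0 : (0 < D)%N by case: D sD.
elim: s sD => [|x s IH] sD ys; first by exists (fun=> 1) => //; exact: pert_deg_cst.
move: ys; rewrite inE negb_or => /andP[yx ys].
have [f fs [fy f0]] := IH (ltnW sD) ys.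
have [k xk] : exists k, y ord0 k - x ord0 k != 0.
  apply/not_existsP => h; case/eqP: yx; apply/rowP => k.
  by apply/eqP; rewrite -subr_eq0; apply/negPn/negP => /(h k).
pose a := (y ord0 k - x ord0 k)^-1.
exists (fun z : 'rV_d => a * (z ord0 k * f z) + (- (a * x ord0 k)) * f z).
  apply: pert_degD; apply: pert_degZ; first exact: pert_degX.
  exact: pert_degW fs.
split; first by rewrite fy mulr1 mulr1 -mulrBr mulVf.
move=> z; rewrite inE => /predU1P[->|zs]; first by rewrite mulrA mulNr subrr.
by rewrite f0// !mulr0 addr0.
Qed.

(** Lagrange interpolation: the basis function of [y] has one factor for each of the at most
    [2 * D - 1] other points, which is just the degree available. *)
Lemma pert_interpolation (s : seq 'rV[R]_d) (g : 'rV[R]_d -> R) :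
  uniq s -> (size s <= 2 * D)%N ->
  exists c, {in s, forall x, pert c x = g x}.
Proof.
move=> us sD.
have /choice[c cP] : forall y : 'rV[R]_d, exists c : 'rV[R]_N, y \in s ->
    pert c y = 1 /\ {in s, forall x, x != y -> pert c x = 0}.
  move=> y; have [ys|] := boolP (y \in s); last by exists 0.
  have [||f [c fc _] [fy f0]] := @pert_separate (rem y s) y.
  - by rewrite size_rem// prednK// -has_predT; apply/hasP; exists y.
  - by rewrite mem_rem_uniq// inE eqxx.
  exists c => _; rewrite -!fc; split=> // x xs xy.
  by rewrite -fc f0// mem_rem_uniq// inE xy.
exists (\sum_(y <- s) g y *: c y) => x xs.
have -> : pert (\sum_(y <- s) g y *: c y) x = \sum_(y <- s) g y * pert (c y) x.
  elim: (s) => [|y s' IH]; last by rewrite !big_cons pertD pertZ IH.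
  by rewrite !big_nil -(scale0r 0) pertZ mul0r.
rewrite (bigD1_seq x)//= (cP x xs).1 mulr1 big1_seq ?addr0// => y /andP[yx ys].
by rewrite (cP y ys).2 ?mulr0// eq_sym.
Qed.

End Interpolation.

(** * Strict differentiability of continuously differentiable maps *)

Section ContinuouslyDifferentiable.
Variable R : realType.

Lemma derive_line n (g : 'rV[R]_n -> R) (x v : 'rV[R]_n) (s : R) :
  derivable g (s *: v + x) v ->
  is_derive s 1 (fun t : R => g (t *: v + x)) ('D_v g (s *: v + x)).
Proof.
move=> dg; have E : (fun h : R => h^-1 *: (((fun t => g (t *: v + x)) \o shift s)
      (h *: 1) - g (s *: v + x))) =
    (fun h => h^-1 *: ((g \o shift (s *: v + x)) (h *: v) - g (s *: v + x))).
  apply/funext => h /=.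
  by rewrite scalerDl addrA -[h *: 1]/(h * 1) mulr1.
by apply: DeriveDef; rewrite /derivable /derive /= E.
Qed.

Lemma mean_value_line n (g : 'rV[R]_n -> R) (x v : 'rV[R]_n) (t a e : R) :
  (forall y, derivable g y v) ->
  (forall s, 0 <= s <= t \/ t <= s <= 0 -> `|'D_v g (s *: v + x) - a| <= e) ->
  `|g (t *: v + x) - g x - t * a| <= e * `|t|.
Proof.
move=> dg Ha.
(* The mean value theorem wants ordered end points; a negative [t] is treated by exchanging them. *)
have H b c : b <= c ->
    (forall s, b <= s <= c -> `|'D_v g (s *: v + x) - a| <= e) ->
    `|g (c *: v + x) - g (b *: v + x) - (c - b) * a| <= e * (c - b).
  move=> bc Hs.
  have [||s] := @MVT_segment R (fun t => g (t *: v + x))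
      (fun s => 'D_v g (s *: v + x)) b c bc.
  - by move=> s _; exact: derive_line.
  - apply: derivable_within_continuous => s _.
    by have [] := @derive_line n g x v s (dg _).
  rewrite in_itv /= => /Hs sa ->.
  rewrite [_ * (c - b)]mulrC -mulrBr normrM ger0_norm ?subr_ge0// mulrC.
  by rewrite ler_wpM2r// subr_ge0.
have [t0|t0] := leP 0 t.
  have := H 0 t t0; rewrite scale0r add0r subr0 => {}H; rewrite (ger0_norm t0).
  by apply: H => s st; apply: Ha; left.
have := H t 0 (ltW t0); rewrite scale0r add0r sub0r => {}H; rewrite (ltr0_norm t0).
have -> : g (t *: v + x) - g x - t * a = - (g x - g (t *: v + x) - (- t * a)).
  by ring.
rewrite normrN.
by apply: H => s st; apply: Ha; right.
Qed.

(** The passage from [v] to [u] changes one coordinate at a time, and the mean value theorem is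
    applied on each leg, where the partial derivative is close to its value at [x0]. *)
Lemma C1_scalar_sdiff n (g : 'rV[R]_n -> R) (x0 : 'rV[R]_n) :
  (forall i x, derivable g x (basis_vec R i)) ->
  (forall i e, 0 < e -> \forall x \near x0,
     `|'D_(basis_vec R i) g x - 'D_(basis_vec R i) g x0| <= e) ->
  sdiff g x0 (fun h => \sum_(i < n) h ord0 i * 'D_(basis_vec R i) g x0).
Proof.
(* Dividing by [n.+1] instead of [n] keeps the divisor nonzero when [n = 0]. *)
move=> dg cg e e0; pose e' := e / n.+1%:R.
have e'0 : 0 < e' by rewrite divr_gt0// ltr0n.
have : \forall x \near x0, forall i : 'I_n,
    `|'D_(basis_vec R i) g x - 'D_(basis_vec R i) g x0| <= e'.
  exact: (@filter_forall _ _ _ (nbhs x0) _ (fun i => cg i e' e'0)).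
move=> /nbhs_ballP[r /= r0 Hr]; apply/near_pair_ball; exists r => // u v ur vr /=.
pose hyb (k : nat) : 'rV[R]_n := \row_i (if (i < k)%N then u ord0 i else v ord0 i).
have hyb0 : hyb 0%N = v by apply/rowP => i; rewrite mxE.
have hybn : hyb n = u by apply/rowP => i; rewrite mxE ltn_ord.
have hybS (k : 'I_n) :
    hyb k.+1 = (u ord0 k - v ord0 k) *: basis_vec R k + hyb k.
  apply/rowP => i; rewrite !mxE eqxx /= ltnS leq_eqVlt.
  have [->|ik] := eqVneq i k; first by rewrite eqxx ltnn /= mulr1 subrK.
  have -> : (i == k :> nat) = false by apply/negbTE.
  by rewrite mulr0 add0r.
have step (k : 'I_n) : `|g (hyb k.+1) - g (hyb k) -
    (u ord0 k - v ord0 k) * 'D_(basis_vec R k) g x0| <= e' * `|u - v|.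
  rewrite hybS; apply: (@le_trans _ _ (e' * `|u ord0 k - v ord0 k|)); last first.
    rewrite ler_pM2l// (le_trans _ (ler_mx_entry _ ord0 k))// !mxE.
    exact: lexx.
  apply: mean_value_line => [y|s st]; first exact: dg.
  apply: Hr; rewrite -ball_normE /= distrC.
  (* The legs stay in the box spanned by [u] and [v], and in the sup norm that box is no farther
     from [x0] than [u] and [v] are. *)
  apply: (@le_lt_trans _ _ (Num.max `|u - x0| `|v - x0|)); last first.
    by rewrite gt_max ur vr.
  apply: ler_rV_norm => [|i]; first by rewrite le_max normr_ge0.
  have ui := ler_mx_entry (u - x0) ord0 i.
  have vi := ler_mx_entry (v - x0) ord0 i.
  rewrite !mxE /= in ui vi *.
  rewrite le_max; have [ik|ik] := eqVneq i k; last first.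
    rewrite mulr0 add0r; case: ifP => _; first by rewrite ui.
    by rewrite vi orbT.
  rewrite {i}ik ltnn mulr1 in ui vi *.
  suff : `|s + v ord0 k - x0 ord0 k| <=
      Num.max `|u ord0 k - x0 ord0 k| `|v ord0 k - x0 ord0 k|.
    rewrite le_max => /orP[h|h]; apply/orP; [left|right]; exact: le_trans h _.
  set M := Num.max _ _.
  have : `|u ord0 k - x0 ord0 k| <= M by rewrite le_max lexx.
  have : `|v ord0 k - x0 ord0 k| <= M by rewrite le_max lexx orbT.
  rewrite !ler_norml => /andP[? ?] /andP[? ?].
  by case: st => /andP[? ?]; apply/andP; split; lra.
have -> : g u - g v - \sum_(i < n) (u - v) ord0 i * 'D_(basis_vec R i) g x0 =
    \sum_(k < n) (g (hyb k.+1) - g (hyb k) -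
    (u ord0 k - v ord0 k) * 'D_(basis_vec R k) g x0).
  rewrite sumrB; congr (_ - _); last by apply: eq_bigr => i _; rewrite !mxE.
  rewrite -(big_mkord xpredT (fun k => g (hyb k.+1) - g (hyb k))) telescope_sumr//.
  by rewrite hyb0 hybn.
rewrite (le_trans (ler_norm_sum _ _ _))//.
rewrite (le_trans (ler_sum _ (fun k _ => step k)))//.
rewrite sumr_const card_ord -mulrnAl ler_wpM2r// /e' -mulr_natr -mulrA.
by rewrite ger_pMr// mulrC ler_pdivrMr ?ltr0n// mul1r ler_nat.
Qed.

Lemma C1_sdiff n p (f : 'rV[R]_n -> 'rV[R]_p) (x0 : 'rV[R]_n) :
  Ck 1 f -> exists A, sdiff f x0 (fun h => h *m A).
Proof.
move=> [df cf].
exists (\matrix_(i, j) ('D_(basis_vec R i) f x0) ord0 j).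
apply/sdiff_coord => j.
have dfj i x : derivable (fun x => f x ord0 j) x (basis_vec R i).
  by have /derivable_mxP := df i x; apply.
have DE i x : 'D_(basis_vec R i) (fun x => f x ord0 j) x =
    ('D_(basis_vec R i) f x) ord0 j.
  by rewrite (derive_mx (df i x)) mxE.
have H : sdiff (fun x => f x ord0 j) x0
    (fun h => \sum_(i < n) h ord0 i * 'D_(basis_vec R i) (fun x => f x ord0 j) x0).
  apply: C1_scalar_sdiff => // i e e0.
  have /cvgrPdist_le/(_ e e0) := cf i x0.
  apply: filterS => x /= xe; rewrite !DE distrC (le_trans _ xe)//.
  by rewrite (le_trans _ (ler_mx_entry _ ord0 j))// !mxE.
apply: sdiff_ext H => h; rewrite mxE; apply: eq_bigr => i _.
by rewrite !mxE DE.
Qed.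

End ContinuouslyDifferentiable.

(** * Projections of zero sets *)

Section Transversality.
Variable R : realType.

Lemma rat_vector_dense n (x : 'rV[R]_n) (e : R) : 0 < e ->
  exists q : 'rV[rat]_n, `|x - map_mx ratr q| <= e.
Proof.
move=> e0.
have /choice[q qP] : forall i, exists q : rat, `|x ord0 i - ratr q| <= e.
  move=> i; have lt : x ord0 i - e < x ord0 i + e by lra.
  have [q] := rat_in_itvoo lt.
  rewrite in_itv /= => /andP[? ?]; exists q; rewrite ler_norml.
  by apply/andP; split; lra.
exists (\row_i q i); apply: ler_rV_norm => [|i]; first exact: ltW.
by rewrite !mxE.
Qed.

(** A Lindelof argument: every point of [Z] lies in a ball of rational centre and radius [1 / k.+1]
    that is small enough for its part of [Z] to project to a null set, and there are countably many
    such balls. *)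
Lemma lebesgue_null_local N n (Z : set 'rV[R]_(N + n)) : (0 < N)%N ->
  (forall w, Z w -> exists2 r : R, 0 < r & lebesgue_null
     [set c | exists xi, Z (row_mx c xi) /\ `|row_mx c xi - w| < r]) ->
  lebesgue_null [set c : 'rV[R]_N | exists xi, Z (row_mx c xi)].
Proof.
move=> N0 H.
pose B (i : 'rV[rat]_(N + n) * nat) := [set c : 'rV[R]_N | exists xi,
  Z (row_mx c xi) /\ `|row_mx c xi - map_mx ratr i.1| <= i.2.+1%:R^-1].
apply: (@lebesgue_null_sub _ _ _ [set c | exists i, lebesgue_null (B i) /\ B i c]).
  move=> c [xi Zc]; have [r r0 nr] := H _ Zc.
  pose k := Num.truncn (2 / r).
  have kr : k.+1%:R^-1 < r / 2.
    rewrite -[r / 2]invrK invf_div ltf_pV2 ?posrE ?divr_gt0 ?ltr0n//.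
    by rewrite truncnS_gt.
  have k0 : 0 < k.+1%:R^-1 :> R by rewrite invr_gt0 ltr0n.
  have [q qw] := rat_vector_dense (row_mx c xi) k0.
  exists (q, k); split; last by exists xi.
  apply: lebesgue_null_sub nr => c' [xi' [Zc' cq]]; exists xi'; split=> //.
  rewrite -(subrK (map_mx ratr q) (row_mx c' xi')) -addrA.
  rewrite (le_lt_trans (ler_normD _ _))//.
  rewrite (le_lt_trans (lerD cq _) (_ : k.+1%:R^-1 + k.+1%:R^-1 < r))//.
    by rewrite distrC.
  by rewrite [ltRHS]splitr ltrD.
apply: lebesgue_null_bigcup => // i.
(* Balls whose piece is not null contribute the empty set, by the definition of the union. *)
have [nB|nB] := pselect (lebesgue_null (B i)).
  by apply: lebesgue_null_sub nB => c [].
by apply: lebesgue_null_sub (lebesgue_null0 N0) => c [].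
Qed.

(** [A] has rank [p], so [N - p] further linear coordinates, the columns of [S], complete those
    given by [A]; a row vector [c] is then recovered from [c *m A] and [c *m S] through [Q] and [W].
    Transposes appear because the complement is taken among row spaces. *)
Lemma row_full_complement N p (A : 'M[R]_(N, p)) (B : 'M[R]_(p, N)) :
  B *m A = 1%:M -> exists (k : nat) (S : 'M[R]_(N, k)) (Q : 'M[R]_(p, N))
    (W : 'M[R]_(k, N)), (k + p = N)%N /\ A *m Q + S *m W = 1%:M.
Proof.
move=> BA; have rA : \rank A^T = p.
  rewrite mxrank_tr; apply/eqP; rewrite -[_ == _]/(row_full A).
  by apply/row_fullP; exists B.
have /sub_addsmxP[u uE] : (1%:M <= A^T + A^T^C)%MS.
  by rewrite submx_full// addsmx_compl_full.
exists (\rank A^T^C%MS), (row_base A^T^C%MS)^T, u.1^T, (u.2 *m col_base A^T^C%MS)^T.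
split.
  by rewrite mxrank_compl rA subnK// -rA rank_leq_col.
apply: trmx_inj; rewrite trmx1 linearD /= !trmx_mul !trmxK -mulmxA mulmx_base.
by rewrite uE.
Qed.

(* Along the zero set, c is a Lipschitz function of xi and of N - p linear
   coordinates of c complementary to row_mx c 0 *m A, hence of N - p + n < N
   real parameters. *)
Lemma zero_set_proj_null N n p (G : 'rV[R]_(N + n) -> 'rV[R]_p)
    (w0 : 'rV[R]_(N + n)) (A : 'M[R]_(N + n, p)) : (n < p)%N ->
  sdiff G w0 (fun h => h *m A) ->
  (forall t : 'rV[R]_p, exists c : 'rV[R]_N, row_mx c 0 *m A = t) ->
  exists2 r : R, 0 < r & lebesgue_null [set c : 'rV[R]_N | exists xi,
    G (row_mx c xi) = 0 /\ `|row_mx c xi - w0| < r].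
Proof.
move=> np GA Aonto; pose A1 := usubmx A; pose A2 := dsubmx A.
have mulA c xi : row_mx c xi *m A = c *m A1 + xi *m A2.
  by rewrite -[A]vsubmxK mul_row_col.
have /choice[b bP] : forall i : 'I_p, exists c : 'rV[R]_N,
    c *m A1 = delta_mx ord0 i.
  move=> i; have [c] := Aonto (delta_mx ord0 i); exists c.
  by rewrite -p0 mulA mul0mx addr0.
have BA : (\matrix_i b i) *m A1 = 1%:M.
  by apply/row_matrixP => i; rewrite row_mul rowK bP row1.
have [k [S [Q [W [kN QW]]]]] := row_full_complement BA.
have [C1 C10 C1P] := mulmx_bounded Q; have [C2 C20 C2P] := mulmx_bounded W.
have [C3 C30 C3P] := mulmx_bounded A2; have [C4 C40 C4P] := mulmx_bounded S.
(* With this precision [C1 * eta] is one half, so the term in the norm of [e] on the right of the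
   final estimate is absorbed by the left. *)
pose eta : R := (2 * C1)^-1.
have eta0 : 0 < eta by rewrite invr_gt0 mulr_gt0.
have [r r0 Hr] := (near_pair_ball _ _).1 (GA _ eta0).
exists r => //.
pose Z := [set w : 'rV[R]_(N + n) | G w = 0 /\ `|w - w0| < r].
apply: (@lebesgue_null_sub _ _ _ (lsubmx @` Z)).
  by move=> c [xi [? ?]]; exists (row_mx c xi) => //; rewrite row_mxKl.
pose u (w : 'rV[R]_(N + n)) := row_mx (lsubmx w *m S) (rsubmx w).
apply: (@lipschitz_image_null R _ (k + n) N Z u (@lsubmx R 1 N n)
  ((C4 + 1) * (`|w0| + r)) (2 * (C1 * (eta + C3) + C2))).
- by rewrite -kN ltn_add2l.
- move=> w [_ wr]; rewrite (le_trans (norm_row_mx_le _ _))//.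
  have ww : `|w| <= `|w0| + r.
    rewrite -(subrK w0 w) (le_trans (ler_normD _ _))// addrC lerD2l.
    exact: ltW.
  have := norm_row_mxl (lsubmx w) (rsubmx w).
  have := norm_row_mxr (lsubmx w) (rsubmx w).
  rewrite hsubmxK => rw lw; rewrite mulrDl mul1r lerD ?(le_trans rw)//.
  by rewrite (le_trans (C4P _))// ler_pM2l// (le_trans lw).
move=> w w' [w0' wr] [w'0 w'r].
(* At two zeros of [G] the difference of values vanishes, so strict differentiability bounds the
   linear part itself. *)
have := Hr w w' wr w'r; rewrite /= w0' w'0 subrr sub0r normrN.
set e := lsubmx w - lsubmx w'; pose z := rsubmx w - rsubmx w'.
have -> : w - w' = row_mx e z.
  by rewrite -{1}(hsubmxK w) -{1}(hsubmxK w') opp_row_mx add_row_mx.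
rewrite mulA => h1.
have h2 := le_trans h1 (ler_wpM2l (ltW eta0) (norm_row_mx_le e z)).
have h3 : `|e *m A1| <= eta * `|e| + (eta + C3) * `|z|.
  rewrite -[e *m A1](addrK (z *m A2)) (le_trans (ler_normB _ _))//.
  rewrite (le_trans (lerD h2 (C3P z)))// mulrDr mulrDl.
  by rewrite addrA.
have h4 : `|e| <= C1 * `|e *m A1| + C2 * `|e *m S|.
  rewrite -{1}[e]mulmx1 -QW mulmxDr !mulmxA (le_trans (ler_normD _ _))//.
  by rewrite lerD.
have uu : u w - u w' = row_mx (e *m S) z.
  by rewrite /u opp_row_mx add_row_mx /e mulmxBl.
have := norm_row_mxl (e *m S) z; have := norm_row_mxr (e *m S) z.
rewrite -uu => zu eu.
have E1 : C1 * eta = 2^-1.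
  by rewrite /eta invfM mulrCA divff ?gt_eqF// mulr1.
have h5 := ler_wpM2l (ltW C10) h3; rewrite mulrDr !mulrA E1 in h5.
have h6 := ler_wpM2l (ltW C20) eu.
have C13 : 0 <= C1 * (eta + C3) by rewrite mulr_ge0 ?addr_ge0 ?ltW.
have h7 := ler_wpM2l C13 zu.
(* Half of the norm of [e] moves to the left, which accounts for the factor 2 in the Lipschitz
   constant. *)
rewrite -mulrA mulrDl; lra.
Qed.

End Transversality.

(** * Linearization of perturbed orbits *)

Section PerturbedOrbits.
Variables (R : realType) (d D : nat) (hd : (0 < d)%N).
Variable phi : 'rV[R]_d -> 'rV[R]_d.
Hypothesis phiC1 : Ck 1 phi.
Local Notation N := (Dalpha d D).
Local Notation o1 := (Ordinal hd).
Local Notation e1 := (basis_vec R o1).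

Lemma monom_sdiff (al : multi_index d D) (x0 : 'rV[R]_d) :
  exists a : 'cV[R]_d, sdiff (monom al) x0 (fun h => (h *m a) ord0 ord0).
Proof.
have coord k : sdiff (fun x : 'rV[R]_d => x ord0 k) x0
    (fun h => (h *m delta_mx k ord0 : 'rV[R]_1) ord0 ord0).
  have := sdiff_mulmx (delta_mx k ord0 : 'cV[R]_d) x0.
  move=> /sdiff_coord/(_ ord0) + e e0 => /(_ e e0).
  apply: filterS => -[x y] /=.
  have E (z : 'rV[R]_d) : (z *m delta_mx k ord0 : 'rV[R]_1) ord0 ord0 = z ord0 k.
    rewrite mxE (bigD1 k)//= mxE !eqxx mulr1 big1 ?addr0// => i /negbTE ik.
    by rewrite mxE ik mulr0.
  by rewrite !E.
have mul f g : (exists a : 'cV[R]_d, sdiff f x0 (fun h => (h *m a) ord0 ord0)) ->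
    (exists a : 'cV[R]_d, sdiff g x0 (fun h => (h *m a) ord0 ord0)) ->
    exists a : 'cV[R]_d, sdiff (fun x => f x * g x) x0 (fun h => (h *m a) ord0 ord0).
  move=> [a fa] [b gb]; exists (f x0 *: b + g x0 *: a).
  apply: sdiff_ext (sdiffM (bounded_mulmx1 a) (bounded_mulmx1 b) fa gb) => h.
  by rewrite mulmxDr -!scalemxAr !mxE.
have one : exists a : 'cV[R]_d,
    sdiff (fun=> 1 : R) x0 (fun h => (h *m a) ord0 ord0).
  exists 0; apply: sdiff_ext (sdiff_cst (1 : R) x0) => h.
  by rewrite mulmx0 mxE.
have pow k m : exists a : 'cV[R]_d,
    sdiff (fun x : 'rV[R]_d => x ord0 k ^+ m) x0 (fun h => (h *m a) ord0 ord0).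
  elim: m => [|m IH].
    have -> : (fun x : 'rV[R]_d => x ord0 k ^+ 0) = (fun=> 1).
      by apply/funext => x; rewrite expr0.
    exact: one.
  have -> : (fun x : 'rV[R]_d => x ord0 k ^+ m.+1) =
      (fun x => x ord0 k * x ord0 k ^+ m).
    by apply/funext => x; rewrite exprS.
  by apply: mul => //; eexists; exact: coord.
have prod (q : 'I_d -> nat) (s : seq 'I_d) : exists a : 'cV[R]_d,
    sdiff (fun x : 'rV[R]_d => \prod_(i <- s) x ord0 i ^+ q i) x0
      (fun h => (h *m a) ord0 ord0).
  elim: s => [|k s IH].
    have -> : (fun x : 'rV[R]_d => \prod_(i <- [::]) x ord0 i ^+ q i) = (fun=> 1).
      by apply/funext => x; rewrite big_nil.
    exact: one.
  have -> : (fun x : 'rV[R]_d => \prod_(i <- k :: s) x ord0 i ^+ q i) =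
      (fun x => x ord0 k ^+ q k * \prod_(i <- s) x ord0 i ^+ q i).
    by apply/funext => x; rewrite big_cons.
  exact: mul.
exact: (prod (fun i => val al i)).
Qed.

(** The second clause isolates the parameter direction: since [phi_c] is affine in [c], a variation
    of [c] acts only through the value at [x0] of its polynomial, and only along the first axis. *)
Lemma phi_c_sdiff (c0 : 'rV[R]_N) (x0 : 'rV[R]_d) :
  exists A : 'M[R]_(N + d, d),
    sdiff (fun u => phi_c D hd phi (lsubmx u) (rsubmx u)) (row_mx c0 x0)
      (fun h => h *m A) /\
    forall c x, row_mx c x *m A = row_mx 0 x *m A + pert c x0 *: e1.
Proof.
pose w0 := row_mx c0 x0.
(* The two projections are written as matrix products so that the rule for linear maps and the chain
   rule apply. *)
have lsubE (w : 'rV[R]_(N + d)) : lsubmx w = w *m (col_mx 1%:M 0).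
  by rewrite -{2}[w]hsubmxK mul_row_col mulmx1 mulmx0 addr0.
have rsubE (w : 'rV[R]_(N + d)) : rsubmx w = w *m (col_mx 0 1%:M).
  by rewrite -{2}[w]hsubmxK mul_row_col mulmx1 mulmx0 add0r.
have sl : sdiff (fun w : 'rV[R]_(N + d) => lsubmx w) w0 (fun h => h *m col_mx 1%:M 0).
  by rewrite (funext lsubE); exact: sdiff_mulmx.
have sr : sdiff (fun w : 'rV[R]_(N + d) => rsubmx w) w0 (fun h => h *m col_mx 0 1%:M).
  by rewrite (funext rsubE); exact: sdiff_mulmx.
have [B phiB] := C1_sdiff (rsubmx w0) phiC1.
have sphi : sdiff (fun w : 'rV[R]_(N + d) => phi (rsubmx w)) w0
    (fun h => h *m (col_mx 0 1%:M *m B)).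
  apply: sdiff_ext (sdiff_comp _ (bounded_mulmx B) sr phiB).
    by move=> h; rewrite mulmxA.
  by move=> x y; rewrite mulmxDl.
have sterm al : exists a : 'cV[R]_(N + d), sdiff (fun w : 'rV[R]_(N + d) =>
      (lsubmx w) ord0 (enum_rank al) * monom al (rsubmx w)) w0
      (fun h => (h *m a) ord0 ord0) /\
    forall h : 'rV[R]_(N + d),
      (h *m a) ord0 ord0 = (row_mx 0 (rsubmx h) *m a) ord0 ord0
      + (lsubmx h) ord0 (enum_rank al) * monom al x0.
  have [a0 ma0] := monom_sdiff al (rsubmx w0).
  have sm : sdiff (fun w : 'rV[R]_(N + d) => monom al (rsubmx w)) w0
      (fun h => (h *m (col_mx 0 1%:M *m a0)) ord0 ord0).
    apply: sdiff_ext (sdiff_comp _ (bounded_mulmx1 a0) sr ma0).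
      by move=> h; rewrite mulmxA.
    by move=> x y; rewrite mulmxDl mxE.
  pose a1 : 'cV[R]_(N + d) := col (enum_rank al) (col_mx 1%:M 0).
  have a1E (h : 'rV[R]_(N + d)) : (h *m a1) ord0 ord0 = (lsubmx h) ord0 (enum_rank al).
    by rewrite /a1 colE mulmxA -lsubE -colE mxE.
  have sc : sdiff (fun w : 'rV[R]_(N + d) => (lsubmx w) ord0 (enum_rank al)) w0
      (fun h => (h *m a1) ord0 ord0).
    have /sdiff_coord/(_ (enum_rank al)) := sl.
    by apply: sdiff_ext => h; rewrite a1E lsubE.
  exists ((lsubmx w0) ord0 (enum_rank al) *: (col_mx 0 1%:M *m a0)
    + monom al (rsubmx w0) *: a1).
  split.
    apply: sdiff_ext (sdiffM (bounded_mulmx1 _) (bounded_mulmx1 _) sc sm) => h.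
    by rewrite mulmxDr -!scalemxAr !mxE.
  have aE (al' be' : R) (h : 'rV[R]_(N + d)) :
      (h *m (al' *: (col_mx 0 1%:M *m a0) + be' *: a1)) ord0 ord0 = al' * (rsubmx h *m a0) ord0 ord0
        + be' * (lsubmx h) ord0 (enum_rank al).
    rewrite mulmxDr -!scalemxAr [h *m (_ *m a0)]mulmxA -rsubE mxE.
    by rewrite [X in X + _]mxE [X in _ + X]mxE a1E.
  move=> h; rewrite !aE !row_mxKl !row_mxKr.
  have -> : (0 : 'rV[R]_N) ord0 (enum_rank al) = 0 by rewrite mxE.
  rewrite mulr0 addr0.
  by rewrite [monom _ _ * _]mulrC.
have /choice[a aP] := sterm.
exists (col_mx 0 1%:M *m B + (\sum_al a al) *m e1); split.
  have sp : sdiff (fun w : 'rV[R]_(N + d) => pert (lsubmx w) (rsubmx w)) w0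
      (fun h => (h *m (\sum_al a al)) ord0 ord0).
    have gen (s : seq (multi_index d D)) : sdiff (fun w : 'rV[R]_(N + d) =>
        \sum_(be <- s) (lsubmx w) ord0 (enum_rank be) * monom be (rsubmx w)) w0
        (fun h => (h *m (\sum_(be <- s) a be)) ord0 ord0).
      elim: s => [|al s IH].
        rewrite big_nil.
        have -> : (fun w : 'rV[R]_(N + d) => \sum_(al <- [::])
           (lsubmx w) ord0 (enum_rank al) * monom al (rsubmx w)) = (fun=> 0).
          by apply/funext => w; rewrite big_nil.
        by apply: sdiff_ext (sdiff_cst (0 : R) w0) => h; rewrite mulmx0 mxE.
      have -> : (fun w : 'rV[R]_(N + d) => \sum_(be <- al :: s)
          (lsubmx w) ord0 (enum_rank be) * monom be (rsubmx w)) =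
        (fun w => (lsubmx w) ord0 (enum_rank al) * monom al (rsubmx w) +
          \sum_(be <- s) (lsubmx w) ord0 (enum_rank be) * monom be (rsubmx w)).
        by apply/funext => w; rewrite big_cons.
      apply: sdiff_ext (sdiffD (aP al).1 IH) => h.
      by rewrite big_cons mulmxDr [RHS]mxE.
    exact: gen.
  have se : sdiff (fun w : 'rV[R]_(N + d) => pert (lsubmx w) (rsubmx w) *: e1) w0
      (fun h => h *m ((\sum_al a al) *m e1)).
    apply/sdiff_coord => j e e0.
    apply: filterS (sp e e0) => -[u v] /= uv.
    have E (y : 'rV[R]_1) : (y *m e1) ord0 j = y ord0 ord0 * e1 ord0 j.
      by rewrite mxE big_ord1.
    have E' (y : R) : (y *: e1) ord0 j = y * e1 ord0 j by rewrite mxE.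
    rewrite mulmxA E !E' -!mulrBl normrM; apply: le_trans uv.
    apply: ler_piMr => //; rewrite mxE.
    by case: (_ && _); rewrite ?normr1 ?normr0.
  apply: sdiff_ext (sdiffD sphi se) => h.
  by rewrite mulmxDr.
move=> c x; rewrite !mulmxDr -addrA; congr (_ + _).
  by rewrite !mulmxA !mul_row_col !mulmx0 !mulmx1 !add0r.
have E (h : 'rV[R]_(N + d)) :
    (h *m \sum_al a al) *m e1 = (h *m \sum_al a al) ord0 ord0 *: e1.
  by apply/rowP => j; rewrite mxE big_ord1 [in RHS]mxE.
rewrite !mulmxA !E -scalerDl; congr (_ *: _).
rewrite !mulmx_sumr !summxE /pert -big_split; apply: eq_bigr => al _.
by rewrite (aP al).2 row_mxKl row_mxKr.
Qed.

Definition orb (c : 'rV[R]_N) (x : 'rV[R]_d) (j : nat) := iter j (phi_c D hd phi c) x.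

Lemma orbD c x i j : orb c (orb c x i) j = orb c x (j + i).
Proof. by rewrite /orb iterD. Qed.

(* The linearized orbit is driven by the values of the polynomial perturbation
   along the unperturbed orbit. *)
Lemma orbit_sdiff M (P : 'M[R]_(M, N)) (Q : 'M[R]_(M, d)) (w0 : 'rV[R]_M) :
  let c0 := w0 *m P in let x0 := w0 *m Q in
  exists (A : nat -> 'M[R]_(M, d)) (B : nat -> 'M[R]_d),
  [/\ forall j, sdiff (fun w => orb (w *m P) (w *m Q) j) w0 (fun h => h *m A j),
      A 0%N = Q &
      forall j h, h *m A j.+1 =
        h *m A j *m B j + pert (h *m P) (orb c0 x0 j) *: e1].
Proof.
move=> c0 x0.
have /choice[F FP] : forall x, exists A : 'M[R]_(N + d, d),
    sdiff (fun u => phi_c D hd phi (lsubmx u) (rsubmx u)) (row_mx c0 x)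
      (fun h => h *m A) /\
    forall c y, row_mx c y *m A = row_mx 0 y *m A + pert c x *: e1.
  by move=> x; exact: phi_c_sdiff.
(* Chain rule along the orbit: the pair of [c] and the [i]-th point has derivative [row_mx P (A i)],
   and one more step of [phi_c] multiplies it by [F]. *)
pose A := fix A j := if j is i.+1 then row_mx P (A i) *m F (orb c0 x0 i) else Q.
exists A, (fun j => dsubmx (F (orb c0 x0 j))).
split=> //.
  elim=> [|j IH]; first exact: sdiff_mulmx.
  have sP := sdiff_row_mx (sdiff_mulmx P w0) IH.
  have [sF _] := FP (orb c0 x0 j).
  have -> : (fun w => orb (w *m P) (w *m Q) j.+1) =
      (fun u : 'rV[R]_(N + d) => phi_c D hd phi (lsubmx u) (rsubmx u)) \o
      (fun w => row_mx (w *m P) (orb (w *m P) (w *m Q) j)).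
    by apply/funext => w /=; rewrite row_mxKl row_mxKr.
  apply: sdiff_ext (sdiff_comp _ (bounded_mulmx _) sP sF) => [h|x y].
    by rewrite /= mulmxA.
  by rewrite mulmxDl.
move=> j h /=; have [_ FE] := FP (orb c0 x0 j).
rewrite mulmxA mul_mx_row FE; congr (_ + _).
by rewrite -{1}[F _]vsubmxK mul_row_col mul0mx add0r.
Qed.

(** The system is triangular: once [V j] is known, [v j (V j)] is the perturbation value at [z j]
    that brings the first coordinate of [V j.+1] to [t j]. The values found recursively along [U]
    are then interpolated at the distinct points [z j], together with zeros on [E]. *)
Lemma orbit_control (z : nat -> 'rV[R]_d) (E : seq 'rV[R]_d) (n : nat)
    (B : nat -> 'M[R]_d) (t : nat -> R) :
  {in gtn n &, injective z} -> (forall i, (i < n)%N -> z i \notin E) ->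
  (n + size E <= 2 * D)%N ->
  exists c : 'rV[R]_N, {in E, forall x, pert c x = 0} /\
    forall V : nat -> 'rV[R]_d, V 0%N = 0 ->
      (forall j, V j.+1 = V j *m B j + pert c (z j) *: e1) ->
      forall j, (j < n)%N -> V j.+1 ord0 o1 = t j.
Proof.
move=> zinj zE nE.
pose v j (V : 'rV[R]_d) := t j - (V *m B j) ord0 o1.
pose U := fix U j := if j is i.+1 then U i *m B i + v i (U i) *: e1 else 0.
pose zs := [seq z i | i <- iota 0 n].
have uzs : uniq zs.
  rewrite map_inj_in_uniq ?iota_uniq// => i j; rewrite !mem_iota /= add0n => ? ?.
  exact: zinj.
pose g x := if x \in zs then v (index x zs) (U (index x zs)) else 0.
(* [E] may contain repetitions, whereas interpolation needs distinct points. *)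
have [||c cP] := @pert_interpolation R d D (zs ++ undup E) g.
- rewrite cat_uniq uzs undup_uniq andbT /=; apply/hasPn => x.
  rewrite mem_undup => xE; apply/mapP; case=> i;
  rewrite mem_iota /= add0n => ilt xz.
  by have := zE i ilt; rewrite -xz xE.
- rewrite size_cat size_map size_iota (leq_trans _ nE)// leq_add2l.
  exact: size_undup.
exists c; split.
  move=> x xE; rewrite cP ?mem_cat ?mem_undup ?xE ?orbT// /g ifF//.
  apply/mapP; case=> i; rewrite mem_iota /= add0n => ilt xz.
  by have := zE i ilt; rewrite -xz xE.
have cz j : (j < n)%N -> pert c (z j) = v j (U j).
  move=> jn; have zj : z j \in zs by apply: map_f; rewrite mem_iota.
  rewrite cP ?mem_cat ?zj// /g zj.
  have -> // : index (z j) zs = j.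
  rewrite -[z j](_ : nth 0 zs j = z j) ?index_uniq ?size_map ?size_iota//.
  by rewrite (nth_map 0%N) ?size_iota// nth_iota.
move=> V V0 VS.
have VU j : (j <= n)%N -> V j = U j.
  elim: j => [//|j IH] jn; rewrite VS cz// IH//; exact: ltnW.
move=> j jn; rewrite VU//= !mxE !eqxx mulr1.
by rewrite /v !mxE addrC subrK.
Qed.

End PerturbedOrbits.

(** * Coincidences of the delay map *)

Section DelayMap.
Variables (R : realType) (d D : nat) (hd : (0 < d)%N).
Variable phi : 'rV[R]_d -> 'rV[R]_d.
Hypothesis phiC1 : Ck 1 phi.
Local Notation N := (Dalpha d D).
Local Notation o1 := (Ordinal hd).
Local Notation orb := (@orb R d D hd phi).

Lemma mulmx_coordB M p (A A' : 'I_p -> 'M[R]_(M, d)) (k : 'I_d) (h : 'rV[R]_M)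
    (j : 'I_p) :
  (h *m (\matrix_(i, j) (A j i k - A' j i k))) ord0 j =
  (h *m A j) ord0 k - (h *m A' j) ord0 k.
Proof.
by rewrite !mxE -sumrB; apply: eq_bigr => i _; rewrite mxE mulrBr.
Qed.

Lemma sdiff_row_coordB M p (f f' : 'I_p -> 'rV[R]_M -> 'rV[R]_d)
    (w0 : 'rV[R]_M) (A A' : 'I_p -> 'M[R]_(M, d)) (k : 'I_d) :
  (forall j, sdiff (f j) w0 (fun h => h *m A j)) ->
  (forall j, sdiff (f' j) w0 (fun h => h *m A' j)) ->
  sdiff (fun w => \row_(j < p) (f j w ord0 k - f' j w ord0 k)) w0
    (fun h => h *m \matrix_(i, j) (A j i k - A' j i k)).
Proof.
move=> sA sA'; apply/sdiff_coord => j e e0.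
have e20 : 0 < e / 2 by rewrite divr_gt0.
have /sdiff_coord/(_ k _ e20) S1 := sA j.
have /sdiff_coord/(_ k _ e20) S2 := sA' j.
apply: filterS2 S1 S2 => -[u v] /=; rewrite mulmx_coordB.
set a := ((u - v) *m A j) ord0 k; set a' := ((u - v) *m A' j) ord0 k => S1 S2.
rewrite !mxE; have -> (x x' y y' : R) :
    x - x' - (y - y') - (a - a') = (x - y - a) - (x' - y' - a') by ring.
by rewrite (le_trans (ler_normB _ _))// (splitr e) mulrDl lerD.
Qed.

(** The constant 1 is among the perturbing polynomials, so the parameter space cannot have dimension
    zero. *)
Lemma Dalpha_gt0 : (0 < D)%N -> (0 < N)%N.
Proof.
move=> D0; have [c c1 _] := @pert_deg_cst R d D D0.
rewrite lt0n; apply/eqP => N0.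
have /eqP := c1 0; rewrite /pert big1 ?oner_eq0// => al _.
have h : (0 < N)%N := leq_ltn_trans (leq0n _) (ltn_ord (enum_rank al)).
by rewrite N0 in h.
Qed.

Lemma delay_map_eq (c : 'rV[R]_N) x y :
  delay_map D hd phi c x = delay_map D hd phi c y ->
  forall j, (j < D)%N -> orb c x j ord0 o1 = orb c y j ord0 o1.
Proof.
by move=> /rowP xy j jD; have := xy (Ordinal jD); rewrite !mxE.
Qed.

Lemma orb_inj (c : 'rV[R]_N) : injective (phi_c D hd phi c) ->
  forall j, injective (fun x => orb c x j).
Proof.
move=> ci; elim=> [|j IH] x y //=; rewrite /orb /= => /ci; exact: IH.
Qed.

(** By injectivity, [i] common steps cancel from a coincidence at times [i < j], and [x] returns to
    itself after [j - i] steps. *)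
Lemma orb_aperiodic_inj (c : 'rV[R]_N) x (n : nat) :
  injective (phi_c D hd phi c) ->
  (forall p, (0 < p)%N -> (p < n)%N -> orb c x p <> x) ->
  {in gtn n &, injective (orb c x)}.
Proof.
move=> ci px.
have H i j : (i < j)%N -> (j < n)%N -> orb c x i <> orb c x j.
  move=> ij jn; rewrite -(subnKC (ltnW ij)) -orbD => E.
  have /esym := orb_inj ci (j := i) E.
  by apply: px; [rewrite subn_gt0|rewrite (leq_ltn_trans (leq_subr _ _))].
move=> i j; rewrite !inE => ilt jlt E.
case: (ltngtP i j) => // ij; first by case: (H _ _ ij jlt).
by case: (H _ _ ij ilt).
Qed.

Let lprojE M1 M2 (w : 'rV[R]_(M1 + M2)) : lsubmx w = w *m col_mx 1%:M 0.
Proof. by rewrite -{2}[w]hsubmxK mul_row_col mulmx1 mulmx0 addr0. Qed.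

Let rprojE M1 M2 (w : 'rV[R]_(M1 + M2)) : rsubmx w = w *m col_mx 0 1%:M.
Proof. by rewrite -{2}[w]hsubmxK mul_row_col mulmx1 mulmx0 add0r. Qed.

(* Here y = phi_c^k x, so that both delay vectors are read off a single orbit,
   and the perturbation at its (j + k - 1)-st point moves the j-th component
   of the difference independently of the preceding ones. *)
Lemma same_orbit_null (k : nat) (U : set 'rV[R]_N) :
  (0 < k)%N -> (k < D)%N -> (d < D)%N ->
  (forall c, U c -> injective (phi_c D hd phi c)) ->
  lebesgue_null [set c | U c /\ exists x,
    (forall p, (0 < p)%N -> (p < 2 * D)%N -> orb c x p <> x) /\
    (forall j, (j < D)%N -> orb c x j ord0 o1 = orb c x (j + k) ord0 o1)].
Proof.
move=> k0 kD dD Ui; have D0 : (0 < D)%N by apply: leq_ltn_trans kD.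
(* Injectivity (through [U]) and aperiodicity are recorded in [Z] because they make the derivative
   onto at the base point [w0]; at the points near it only the vanishing of [G] is used. *)
pose Z := [set w : 'rV[R]_(N + d) | let c := lsubmx w in let x := rsubmx w in
  [/\ U c, forall p, (0 < p)%N -> (p < 2 * D)%N -> orb c x p <> x &
   forall j, (j < D)%N -> orb c x j ord0 o1 = orb c x (j + k) ord0 o1]].
apply: (@lebesgue_null_sub _ _ _ [set c | exists x, Z (row_mx c x)]).
  by move=> c [Uc [x [? ?]]]; exists x; rewrite /Z /= row_mxKl row_mxKr.
apply: lebesgue_null_local => [|w0 [Uc px _]]; first exact: Dalpha_gt0.
pose P : 'M[R]_(N + d, N) := col_mx 1%:M 0.
pose Q : 'M[R]_(N + d, d) := col_mx 0 1%:M.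
have [A [B [As A0 Aj]]] := @orbit_sdiff R d D hd phi phiC1 _ P Q w0.
pose G (w : 'rV[R]_(N + d)) : 'rV[R]_D :=
  \row_(j < D) (orb (w *m P) (w *m Q) j ord0 o1 - orb (w *m P) (w *m Q) (j + k) ord0 o1).
pose GA : 'M[R]_(N + d, D) := \matrix_(i, j) (A j i o1 - A (j + k)%N i o1).
have GAs : sdiff G w0 (fun h => h *m GA).
  have := sdiff_row_coordB o1 (fun j : 'I_D => As j) (fun j : 'I_D => As (j + k)%N).
  exact.
have [|r r0 nr] := zero_set_proj_null dD GAs; last first.
  exists r => //; apply: lebesgue_null_sub nr => c [x [Zcx cxr]].
  exists x; split=> //; apply/rowP => j; rewrite !mxE -lprojE -rprojE.
  by case: Zcx => _ _ -> //; rewrite subrr.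
move=> tau.
pose tau' (l : nat) := if insub l is Some j then tau ord0 j else 0.
(* The solution of [s j - s (j + k) = tau' j] that vanishes on the first [k] indices, obtained by
   summing [tau'] along residue classes modulo [k]. In particular [s 0 = 0], as needed since [c]
   does not move the initial point. *)
pose s (i : nat) := - \sum_(m < i %/ k) tau' (i %% k + m * k)%N.
have s0 : s 0%N = 0 by rewrite /s div0n big_ord0 oppr0.
have sk j : s (j + k)%N = s j - tau' j.
  rewrite /s modnDr divnDr ?dvdnn// divnn k0 addn1 big_ord_recr /= opprD.
  by rewrite [(j %% k + _)%N]addnC -divn_eq.
(* The last component read is [D.-1 + k], driven by the first [D.-1 + k] points of the orbit, at
   most [2 * D - 2] in number. *)
have nk : (D.-1 + k <= 2 * D)%N by lia.
have [|i _||c [_ cP]] := @orbit_control R d D hd (orb (w0 *m P) (w0 *m Q)) [::]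
    (D.-1 + k) B (fun j => s j.+1) _ _ _.
- apply: orb_aperiodic_inj => [|p p0 pk]; rewrite -lprojE; first exact: Ui.
  by rewrite -rprojE; apply: px => //; exact: leq_trans pk nk.
- by [].
- by rewrite addn0.
pose h : 'rV[R]_(N + d) := row_mx c 0.
have hP : h *m P = c by rewrite mul_row_col mulmx1 mulmx0 addr0.
have hQ : h *m Q = 0 by rewrite mul_row_col mul0mx mulmx0 addr0.
have V0 : h *m A 0%N = 0 by rewrite A0.
have VS j : h *m A j.+1 = h *m A j *m B j +
    pert c (orb (w0 *m P) (w0 *m Q) j) *: basis_vec R o1.
  by rewrite Aj hP.
have Vs j : (j <= D.-1 + k)%N -> (h *m A j) ord0 o1 = s j.
  case: j => [_|j jn]; first by rewrite V0 s0 mxE.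
  exact: (cP (fun j => h *m A j) V0 VS).
exists c; rewrite -/h; apply/rowP => j.
have jD := ltn_ord j.
rewrite mulmx_coordB !Vs; [|lia|lia].
by rewrite sk opprB addrCA subrr addr0 /tau' valK.
Qed.

(** The perturbation is made to vanish along the orbit of [x] and to steer that of [y]. Hence only
    [y] has to be aperiodic, and [x] may even be fixed. *)
Lemma disjoint_orbits_null (U : set 'rV[R]_N) :
  (d + d < D.-1)%N ->
  (forall c, U c -> injective (phi_c D hd phi c)) ->
  lebesgue_null [set c | U c /\ exists x y,
    [/\ forall p, (0 < p)%N -> (p < 2 * D)%N -> orb c y p <> y,
        forall i j, (i < D)%N -> (j < D)%N -> orb c x i <> orb c y j &
        forall j, (j < D)%N -> orb c x j ord0 o1 = orb c y j ord0 o1]].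
Proof.
move=> dD Ui; have D0 : (0 < D)%N by lia.
pose Z := [set w : 'rV[R]_(N + (d + d)) | let c := lsubmx w in
  let x := lsubmx (rsubmx w) in let y := rsubmx (rsubmx w) in
  [/\ U c, forall p, (0 < p)%N -> (p < 2 * D)%N -> orb c y p <> y,
   forall i j, (i < D)%N -> (j < D)%N -> orb c x i <> orb c y j &
   forall j, (j < D)%N -> orb c x j ord0 o1 = orb c y j ord0 o1]].
apply: (@lebesgue_null_sub _ _ _ [set c | exists xy, Z (row_mx c xy)]).
  move=> c [Uc [x [y [? ? ?]]]]; exists (row_mx x y).
  by rewrite /Z /= !row_mxKl !row_mxKr row_mxKl.
apply: lebesgue_null_local => [|w0 [Uc py xy _]]; first exact: Dalpha_gt0.
pose P : 'M[R]_(N + (d + d), N) := col_mx 1%:M 0.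
pose Q : 'M[R]_(N + (d + d), d) := col_mx 0 1%:M *m col_mx 1%:M 0.
pose Q' : 'M[R]_(N + (d + d), d) := col_mx 0 1%:M *m col_mx 0 1%:M.
have QE (w : 'rV[R]_(N + (d + d))) : w *m Q = lsubmx (rsubmx w).
  by rewrite mulmxA -rprojE -lprojE.
have Q'E (w : 'rV[R]_(N + (d + d))) : w *m Q' = rsubmx (rsubmx w).
  by rewrite mulmxA -!rprojE.
have [A [B [As A0 Aj]]] := @orbit_sdiff R d D hd phi phiC1 _ P Q w0.
have [A' [B' [A's A'0 A'j]]] := @orbit_sdiff R d D hd phi phiC1 _ P Q' w0.
pose G (w : 'rV[R]_(N + (d + d))) : 'rV[R]_D.-1 := \row_(j < D.-1)
  (orb (w *m P) (w *m Q) j.+1 ord0 o1 - orb (w *m P) (w *m Q') j.+1 ord0 o1).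
pose GA : 'M[R]_(N + (d + d), D.-1) := \matrix_(i, j) (A j.+1 i o1 - A' j.+1 i o1).
have GAs : sdiff G w0 (fun h => h *m GA).
  have := sdiff_row_coordB o1 (fun j : 'I_D.-1 => As j.+1) (fun j : 'I_D.-1 => A's j.+1).
  exact.
have [|r r0 nr] := zero_set_proj_null dD GAs; last first.
  exists r => //; apply: lebesgue_null_sub nr => c [x [Zcx cxr]].
  exists x; split=> //; apply/rowP => j; rewrite [LHS]mxE [RHS]mxE -lprojE QE Q'E.
  have jD := ltn_ord j.
  by case: Zcx => _ _ _ -> //; [rewrite subrr|lia].
move=> tau.
pose tau' (l : nat) := if insub l is Some j then tau ord0 j else 0.
(* The points of the orbit of [x] that drive the components 1 to [D.-1]; they may repeat. *)
pose E := [seq orb (w0 *m P) (w0 *m Q) i | i <- iota 0 D.-1].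
(* The targets carry a minus sign because [G] subtracts the orbit of [y]. *)
have [|i iD||c [cE cP]] := @orbit_control R d D hd (orb (w0 *m P) (w0 *m Q')) E
    D.-1 B' (fun j => - tau' j) _ _ _.
- apply: orb_aperiodic_inj => [|p p0 pk]; rewrite -lprojE; first exact: Ui.
  by rewrite Q'E; apply: py => //; lia.
- apply/mapP; case=> i'; rewrite mem_iota /= add0n => i'D /esym.
  by rewrite -lprojE QE Q'E; apply: xy; lia.
- by rewrite size_map size_iota; lia.
pose h : 'rV[R]_(N + (d + d)) := row_mx c 0.
have hP : h *m P = c by rewrite mul_row_col mulmx1 mulmx0 addr0.
have hQ : h *m Q = 0 by rewrite QE row_mxKr; apply/rowP => i; rewrite !mxE.
have hQ' : h *m Q' = 0 by rewrite Q'E row_mxKr; apply/rowP => i; rewrite !mxE.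
have V0 : h *m A' 0%N = 0 by rewrite A'0.
have VS j : h *m A' j.+1 = h *m A' j *m B' j +
    pert c (orb (w0 *m P) (w0 *m Q') j) *: basis_vec R o1.
  by rewrite A'j hP.
(* With no initial variation and a polynomial vanishing on [E], the linearized orbit of [x] stays at
   zero. *)
have X0 j : (j <= D.-1)%N -> h *m A j = 0.
  elim: j => [_|j IH jD]; first by rewrite A0.
  rewrite Aj hP (IH (ltnW jD)) mul0mx add0r cE ?scale0r//.
  by apply: map_f; rewrite mem_iota.
exists c; rewrite -/h; apply/rowP => j.
have jD := ltn_ord j.
rewrite mulmx_coordB X0// (cP (fun j => h *m A' j) V0 VS)// mxE sub0r opprK.
by rewrite /tau' valK.
Qed.

End DelayMap.

(** * Reduction of non-injectivity to finitely many exceptional parameter sets *)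

Theorem theorem19 (R : realType) (d D : nat) (hd : (0 < d)%N) (hD : (0 < D)%N)
  (hDd : (4 * d + 2 <= D)%N)
  (phi : 'rV[R]_d -> 'rV[R]_d) (r rp : R) (xp : 'rV[R]_d) (a0 : R)
  (m : nat) (xi : 'rV[R]_(Dalpha d D) -> 'I_m -> 'rV[R]_d) :
  Ck_diffeo 1 phi ->
  (* K = cball 0 r, K^+ = cball xp rp *)
  0 < r ->
  cball 0 r `<=` cball xp rp ->
  (forall x j, cball 0 r x -> (j < D)%N -> cball xp rp (iter j phi x)) ->
  0 < a0 ->
  (forall c x j, enorm c <= a0 -> cball 0 r x -> (j < D)%N ->
     cball xp rp (iter j (phi_c D hd phi c) x)) ->
  (* (1) *)
  (forall c, enorm c <= a0 -> Ck_diffeo 3 (phi_c D hd phi c)) ->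
  (* (2) exactly m fixed points xi c 1, ..., xi c m *)
  (forall c, enorm c <= a0 -> injective (xi c)) ->
  (forall c x, enorm c <= a0 ->
     (phi_c D hd phi c x = x <-> exists i, x = xi c i)) ->
  (* (3) no other periodic points of period < 2D *)
  (forall c x p, enorm c <= a0 -> (0 < p)%N -> (p < 2 * D)%N ->
     iter p (phi_c D hd phi c) x = x -> phi_c D hd phi c x = x) ->
  (* (4) hyperbolicity and distinct first coordinates *)
  (forall c i, enorm c <= a0 -> hyperbolic_at (phi_c D hd phi c) (xi c i)) ->
  (forall c i j, enorm c <= a0 -> i != j ->
     xi c i ord0 (Ordinal hd) != xi c j ord0 (Ordinal hd)) ->
  (* (5) F_c immersive at each fixed point *)
  (forall c i, enorm c <= a0 -> injective ('d (delay_map D hd phi c) (xi c i))) ->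
  (* conclusion: for a.e. c with ||c|| < a0, F_c is injective on K *)
  lebesgue_null
    [set c : 'rV[R]_(Dalpha d D) | enorm c < a0 /\
       ~ (forall x y, cball 0 r x -> cball 0 r y ->
            delay_map D hd phi c x = delay_map D hd phi c y -> x = y)].
Proof.
move=> [_ [_ [_ [phiC1 _]]]] r0 _ _ a00 _ diffeo _ fixE per _ fix1 _.
pose U := [set c : 'rV[R]_(Dalpha d D) | enorm c < a0].
have Uinj c : U c -> injective (phi_c D hd phi c).
  by move=> /ltW /diffeo [g [/can_inj]].
pose S1 k := [set c | U c /\ exists x,
  (forall p, (0 < p)%N -> (p < 2 * D)%N -> orb hd phi c x p <> x) /\
  (forall j, (j < D)%N -> orb hd phi c x j ord0 (Ordinal hd) =
     orb hd phi c x (j + k) ord0 (Ordinal hd))].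
pose S2 := [set c | U c /\ exists x y,
  [/\ forall p, (0 < p)%N -> (p < 2 * D)%N -> orb hd phi c y p <> y,
      forall i j, (i < D)%N -> (j < D)%N -> orb hd phi c x i <> orb hd phi c y j &
      forall j, (j < D)%N -> orb hd phi c x j ord0 (Ordinal hd) =
        orb hd phi c y j ord0 (Ordinal hd)]].
have nS1 (k : 'I_D) : (0 < k)%N -> lebesgue_null (S1 k).
  by move=> k0; apply: same_orbit_null => //; lia.
have nS2 : lebesgue_null S2 by apply: disjoint_orbits_null => //; lia.
have N0 : (0 < Dalpha d D)%N := Dalpha_gt0 R d hD.
(* [Some k] stands for two points on one orbit with lag [k], [None] for disjoint orbit segments. Lag
   zero would hold for trivial reasons, so its set is made empty. *)
pose S (k : option 'I_D) := if k is Some k then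
  [set c | (0 < k)%N /\ S1 k c] else S2.
apply: (@lebesgue_null_sub _ _ _ [set c | exists k, S k c]); last first.
  apply: lebesgue_null_bigcup => // -[k|] //=.
  have [k0|k0] := boolP (0 < k)%N; last first.
    by apply: lebesgue_null_sub (@lebesgue_null0 R _ N0) => c [].
  by apply: lebesgue_null_sub (nS1 k k0) => c [].
move=> c [Uc ninj]; have ca0 := ltW Uc.
have [x [y [xy Fxy]]] : exists x y, x <> y /\
    delay_map D hd phi c x = delay_map D hd phi c y.
  apply: contrapT => h; apply: ninj => x y _ _ Fxy.
  by apply: contrapT => xy; apply: h; exists x, y.
have E := delay_map_eq Fxy.
have aper z : phi_c D hd phi c z <> z ->
    forall p, (0 < p)%N -> (p < 2 * D)%N -> orb hd phi c z p <> z.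
  by move=> nz p p0 pD; apply: contra_not nz; exact: per.
have fix_orb z k : phi_c D hd phi c z = z -> orb hd phi c z k = z.
  by move=> fz; elim: k => // k; rewrite /orb /= => ->.
have forward x' y' k : x' <> y' -> (0 < k)%N -> (k < D)%N ->
    y' = orb hd phi c x' k ->
    (forall j, (j < D)%N -> orb hd phi c x' j ord0 (Ordinal hd) =
      orb hd phi c y' j ord0 (Ordinal hd)) -> exists k, S k c.
  move=> xy' k0 kD y'E E'; exists (Some (Ordinal kD)); split=> //; split=> //.
  exists x'; split; last by move=> j jD; rewrite E'// y'E orbD.
  (* A fixed starting point would equal all its iterates, against the two points being distinct. *)
  by apply: aper => fx; apply: xy'; rewrite y'E fix_orb.
have [[k [k0 kD yE]]|ny] := pselect (exists k, [/\ (0 < k)%N, (k < D)%N &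
    y = orb hd phi c x k]).
  exact: forward xy k0 kD yE E.
have [[k [k0 kD xE]]|nx] := pselect (exists k, [/\ (0 < k)%N, (k < D)%N &
    x = orb hd phi c y k]).
  by apply: (forward _ _ _ (nesym xy) k0 kD xE) => j jD; rewrite E.
(* Cancelling the common steps of a meeting of the two orbits would put one point on the forward
   orbit of the other, or make the points equal. *)
have disj i j : (i < D)%N -> (j < D)%N -> orb hd phi c x i <> orb hd phi c y j.
  move=> iD jD; have oi := orb_inj (Uinj c Uc).
  case: (ltngtP i j) => [ij|ij|->]; last by move=> /oi.
  - rewrite -(subnKC (ltnW ij)) -orbD => /oi xE; apply: nx.
    by exists (j - i)%N; split=> //; lia.
  - rewrite -(subnKC (ltnW ij)) -orbD => /oi /esym yE; apply: ny.
    by exists (i - j)%N; split=> //; lia.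
exists None; split=> //.
(* A point that is not fixed takes the role of the aperiodic [y] in [S2]; the two points are
   exchanged if necessary. *)
have [fy|fy] := pselect (phi_c D hd phi c y = y); last first.
  by exists x, y; split=> //; exact: aper.
have [fx|fx] := pselect (phi_c D hd phi c x = x); last first.
  exists y, x; split; first exact: aper.
  - by move=> i j iD jD; apply/nesym/disj.
  - by move=> j jD; rewrite E.
(* Both points are fixed: the component 0 of the delay vectors gives them the same first coordinate,
   which (4) excludes for distinct fixed points. *)
have [i xi_i] := (fixE c x ca0).1 fx; have [j xi_j] := (fixE c y ca0).1 fy.
have ij : i != j by apply: contra_notN xy => /eqP ij; rewrite xi_i xi_j ij.
have := E 0%N hD; rewrite /orb /= => xy1.
by have /eqP[] := fix1 c i j ca0 ij; rewrite -xi_i -xi_j.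
Qed.
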